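(* Let $A$ be a bialgebra over $\mathbf{k}$ with coproduct $\Delta_A$ and counit $\varepsilon_A$, having a $\mathbf{k}$-basis $X$ containing $1$, and let $\lambda\in\mathbf{k}$. Let $(F_{-\lambda^2}(A),\diamond,P_A)$ be the free modified Rota-Baxter algebra of weight $-\lambda^2$ on $A$, and let $\Delta_M:F_{-\lambda^2}(A)\to F_{-\lambda^2}(A)\otimes F_{-\lambda^2}(A)$ and $\varepsilon_M:F_{-\lambda^2}(A)\to\mathbf{k}$ be the modified Rota-Baxter algebra morphisms described in the context. Then the quintuple $(F_{-\lambda^2}(A),\diamond,1,\Delta_M,\varepsilon_M)$ is a bialgebra.
   Context: $\mathbf{k}$ is a commutative unitary ring; all algebras are associative unitary $\mathbf{k}$-algebras, algebra homomorphisms are unital, and $\otimes=\otimes_{\mathbf{k}}$. Modified Rota-Baxter algebras. For $\kappa\in\mathbf{k}$, a modified Rota-Baxter operator of weight $\kappa$ on an algebra $R$ is a linear map $P:R\to R$ with $P(u)P(v)=P(uP(v))+P(P(u)v)+\kappa uv$ for all $u,v\in R$; then $(R,P)$ is a modified Rota-Baxter algebra of weight $\kappa$. Morphisms are algebra homomorphisms commuting with the operators. A free modified Rota-Baxter algebra of weight $\kappa$ on an algebra $A$ is a modified Rota-Baxter algebra $(F(A),P_A)$ of weight $\kappa$ with an algebra homomorphism $j:A\to F(A)$ such that for every modified Rota-Baxter algebra $(R,P)$ of weight $\kappa$ and every algebra homomorphism $f:A\to R$ there is a unique morphism of modified Rota-Baxter algebras $\bar f:F(A)\to R$ with $\bar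 f\circ j=f$. Construction of $F_\kappa(A)$. Let $A$ be an algebra with product $\cdot$ and a $\mathbf{k}$-basis $X$ with $1=1_A\in X$; put $X^+=X\setminus\{1\}$. Let $\lfloor,\rfloor$ be two symbols not in $X$, and $M$ the free monoid on $X^+\cup\{\lfloor,\rfloor\}$, whose empty word is identified with $1$. For $Y,Z\subseteq M$ put $\lfloor Z\rfloor=\{\lfloor z\rfloor: z\in Z\}$ and $$\Lambda(Y,Z)=\bigcup_{r\ge1}(Y\lfloor Z\rfloor)^r\ \cup\ \bigcup_{r\ge0}(Y\lfloor Z\rfloor)^rY\ \cup\ \bigcup_{r\ge1}(\lfloor Z\rfloor Y)^r\ \cup\ \bigcup_{r\ge0}(\lfloor Z\rfloor Y)^r\lfloor Z\rfloor .$$ Put $\mathfrak{X}_0=X^+\cup\{1\}$, $\mathfrak{X}_{n+1}=\Lambda(X^+,\mathfrak{X}_n)\cup\{1\}$ for $n\ge0$, and $\mathfrak{X}_\infty=\bigcup_{n\ge0}\mathfrak{X}_n$. Every $\mathfrak{x}\in\mathfrak{X}_\infty\setminus\{1\}$ has a unique standard decomposition $\mathfrak{x}=\mathfrak{x}_1\cdots\mathfrak{x}_b$ with the $\mathfrak{x}_i$ alternately in $X^+$ and in $\lfloor\mathfrak{X}_\infty\rfloor$. Let $F_\kappa(A)$ be the free $\mathbf{k}$-module with basis $\mathfrak{X}_\infty$, $j_A:A\to F_\kappa(A)$ the linear injection extending $X\hookrightarrow\mathfrak{X}_\infty$, and $P_A$ the linear map with $P_A(\mathfrak{x})=\lfloor\mathfrak{x}\rfloor$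 for $\mathfrak{x}\in\mathfrak{X}_\infty$; also write $\lfloor u\rfloor=P_A(u)$ for any $u\in F_\kappa(A)$. The bilinear product $\diamond$ is defined on basis elements recursively (on the total number of bracket pairs in the two words, then on the total number of letters from $X^+$). First $1\diamond\mathfrak{x}=\mathfrak{x}\diamond1=\mathfrak{x}$. For $\mathfrak{x},\mathfrak{x}'\ne1$ with standard decompositions $\mathfrak{x}=\mathfrak{x}_1\cdots\mathfrak{x}_b$, $\mathfrak{x}'=\mathfrak{x}'_1\cdots\mathfrak{x}'_{b'}$, put $\mathfrak{u}=\mathfrak{x}_1\cdots\mathfrak{x}_{b-1}$, $\mathfrak{v}=\mathfrak{x}'_2\cdots\mathfrak{x}'_{b'}$ (equal to $1$ if empty). If exactly one of $\mathfrak{x}_b,\mathfrak{x}'_1$ is in $X^+$, then $\mathfrak{x}\diamond\mathfrak{x}'=\mathfrak{x}\mathfrak{x}'$ (concatenation). If $\mathfrak{x}_b,\mathfrak{x}'_1\in X^+$ and $\mathfrak{x}_b\cdot\mathfrak{x}'_1=c\,1+\sum_i c_ix_i$ in $A$ with $x_i\in X^+$, then $\mathfrak{x}\diamond\mathfrak{x}'=c\,(\mathfrak{u}\diamond\mathfrak{v})+\sum_ic_i\,\mathfrak{u}x_i\mathfrak{v}$. If $\mathfrak{x}_b=\lfloor\overline{\mathfrak{x}}\rfloor$ and $\mathfrak{x}'_1=\lfloor\overline{\mathfrak{x}}'\rfloor$, then $$\mathfrak{x}\diamond\mathfrak{x}'=\mathfrak{u}\lfloor\lfloor\overline{\mathfrak{x}}\rfloor\diamond\overline{\mathfrak{x}}'\rfloor\mathfrak{v}+\mathfrak{u}\lfloor\overline{\mathfrak{x}}\diamond\lfloor\overline{\mathfrak{x}}'\rfloor\rfloor\mathfrak{v}+\kappa\,\big(\mathfrak{u}\diamond(\overline{\mathfrak{x}}\diamond\overline{\mathfrak{x}}')\big)\diamond\mathfrak{v},$$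 with concatenation and brackets extended linearly. With these data $(F_\kappa(A),\diamond,P_A)$ and $j_A$ form the free modified Rota-Baxter algebra of weight $\kappa$ on $A$. The maps $\varepsilon_M$, $\Delta_M$ (here $\kappa=-\lambda^2$ and $A$ is a bialgebra). The map $-\lambda\,\mathrm{id}$ is a modified Rota-Baxter operator of weight $-\lambda^2$ on $\mathbf{k}$, and $\varepsilon_M:F_{-\lambda^2}(A)\to\mathbf{k}$ is the unique modified Rota-Baxter algebra morphism to $(\mathbf{k},-\lambda\,\mathrm{id})$ with $\varepsilon_M\circ j_A=\varepsilon_A$; so $\varepsilon_M\circ P_A=-\lambda\,\varepsilon_M$. The linear map $Q$ on $F_{-\lambda^2}(A)\otimes F_{-\lambda^2}(A)$ given by $$Q(u\otimes v)=(P_A(u)+\lambda u)\otimes\varepsilon_M(v)1+u\otimes P_A(v)$$ is a modified Rota-Baxter operator of weight $-\lambda^2$ for the componentwise product, and $\Delta_M$ is the unique modified Rota-Baxter algebra morphism from $(F_{-\lambda^2}(A),P_A)$ to $(F_{-\lambda^2}(A)\otimes F_{-\lambda^2}(A),Q)$ with $\Delta_M\circ j_A=(j_A\otimes j_A)\circ\Delta_A$. *)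

(* Defs.v *)
From HB Require Import structures.
From mathcomp Require Import all_boot all_order all_algebra.
From mathcomp Require Import generic_quotient ring_quotient finmap.
From mathcomp.multinomials Require Import monalg.
From mathcomp Require Import boolp zify.

Set Implicit Arguments.
Unset Strict Implicit.
Unset Printing Implicit Defensive.

Import GRing.Theory.
Local Open Scope ring_scope.

(* {malg k[K]} (finitely supported functions K -> k) is used only as the free
   k-module on the choice type K: << x >> is the basis vector of x, g@_x the
   coefficient of g at x. *)

Section FreeModule.
Variables (k : comNzRingType) (K : choiceType).
Implicit Types (g h : {malg k[K]}).

(* The linear extension of f : K -> V. *)
Definition lin (V : lmodType k) (f : K -> V) g : V :=
  \sum_(x <- msupp g) g@_x *: f x.

Lemma lin_wide (V : lmodType k) (f : K -> V) g (d : {fset K}) :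
  (msupp g `<=` d)%fset -> lin f g = \sum_(x <- d) g@_x *: f x.
Proof.
move=> sgd; rewrite /lin [LHS](big_fset_incl _ sgd) //= => x _ xng.
by rewrite mcoeff_outdom ?scale0r.
Qed.

Lemma lin_is_linear (V : lmodType k) (f : K -> V) : linear (lin f).
Proof.
move=> a g h; pose d := (msupp g `|` msupp h)%fset.
have sg : (msupp g `<=` d)%fset by apply: fsubsetUl.
have sh : (msupp h `<=` d)%fset by apply: fsubsetUr.
have sgh : (msupp (a *: g + h) `<=` d)%fset.
  apply: (fsubset_trans (msuppD_le _ _)); apply: fsetSU.
  exact: msuppZ_le.
rewrite (lin_wide f sg) (lin_wide f sh) (lin_wide f sgh) scaler_sumr.
rewrite -big_split /=; apply: eq_bigr => x _.
by rewrite mcoeffD mcoeffZ scalerDl scalerA.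
Qed.

HB.instance Definition _ (V : lmodType k) (f : K -> V) :=
  GRing.isLinear.Build k {malg k[K]} V *:%R (lin f) (lin_is_linear f).

Lemma lin_base (V : lmodType k) (f : K -> V) x : lin f << x >> = f x.
Proof.
rewrite (@lin_wide _ _ _ [fset x]%fset) ?msuppU_le //.
by rewrite big_seq_fset1 mcoeffUU scale1r.
Qed.

End FreeModule.

(* The bilinear extension of f : K -> L -> V. *)
Definition bilin (k : comNzRingType) (K L : choiceType) (V : lmodType k)
    (f : K -> L -> V) (g : {malg k[K]}) (h : {malg k[L]}) : V :=
  lin (fun x => lin (f x) h) g.

(* Tensor product of modules: the free module on U * V modulo the submodule
   generated by the bilinearity relations. *)
Section Tensor.
Variables (k : comNzRingType) (U V : lmodType k).
Local Notation free := {malg k[(U * V)%type]}.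

Definition is_submodule (S : free -> Prop) : Prop :=
  S 0 /\ forall a g h, S g -> S h -> S (a *: g + h).

Definition has_tens_relations (S : free -> Prop) : Prop :=
  (forall a u u' v, S (<< (a *: u + u', v) >> - a *: << (u, v) >> - << (u', v) >>))
  /\ (forall a u v v',
        S (<< (u, a *: v + v') >> - a *: << (u, v) >> - << (u, v') >>)).

Definition tens_rel : {pred free} :=
  [pred g : free | `[< forall S : free -> Prop,
     is_submodule S -> has_tens_relations S -> S g >]].

Lemma tens_relP (g : free) :
  (g \in tens_rel) <->
  (forall S, is_submodule S -> has_tens_relations S -> S g).
Proof. by rewrite inE; split=> [/asboolP|?]; last exact/asboolP. Qed.

Lemma tens_rel_lin a g h :
  g \in tens_rel -> h \in tens_rel -> a *: g + h \in tens_rel.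
Proof.
move=> /tens_relP Sg /tens_relP Sh; apply/tens_relP => S mS rS.
by apply: mS.2; [apply: Sg | apply: Sh].
Qed.

Lemma tens_rel_zmod : zmod_closed tens_rel.
Proof.
split=> [|g h Sg Sh]; first by apply/tens_relP => S [].
by rewrite addrC -scaleN1r tens_rel_lin.
Qed.

HB.instance Definition _ := GRing.isZmodClosed.Build free tens_rel tens_rel_zmod.

Definition tensor : Type := Quotient.quot tens_rel.
HB.instance Definition _ := GRing.Zmodule.on tensor.

Local Open Scope quotient_scope.
Local Notation pi := (\pi_(Quotient.quot tens_rel) : free -> tensor).

Lemma tens_piD g h : pi (g + h) = pi g + pi h.
Proof. exact: raddfD. Qed.

Lemma tens_eqP g h : pi g = pi h <-> g - h \in tens_rel.
Proof. by rewrite Quotient.idealrBE; split=> [/eqP|/eqP]. Qed.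

Lemma tens_reprK (t : tensor) : pi (repr t) = t. Proof. exact: reprK. Qed.

Definition tens_scale (a : k) (t : tensor) : tensor := pi (a *: repr t).

Lemma tens_pi_scale a g : tens_scale a (pi g) = pi (a *: g).
Proof.
apply/tens_eqP; rewrite -scalerBr -[_ *: _]addr0 tens_rel_lin //.
  by apply/tens_eqP; rewrite tens_reprK.
exact: tens_rel_zmod.1.
Qed.

Lemma tens_scaleA a b t : tens_scale a (tens_scale b t) = tens_scale (a * b) t.
Proof. by rewrite {2}/tens_scale tens_pi_scale scalerA. Qed.

Lemma tens_scale1 : left_id 1 tens_scale.
Proof. by move=> t; rewrite /tens_scale scale1r tens_reprK. Qed.

Lemma tens_scaleDr : right_distributive tens_scale +%R.
Proof.
move=> a s t; rewrite -[s]tens_reprK -[t]tens_reprK -tens_piD.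
by rewrite !tens_pi_scale scalerDr tens_piD.
Qed.

Lemma tens_scaleDl t : {morph tens_scale^~ t : a b / a + b}.
Proof. by move=> a b; rewrite /tens_scale scalerDl tens_piD. Qed.

HB.instance Definition _ := GRing.Zmodule_isLmodule.Build k tensor
  tens_scaleA tens_scale1 tens_scaleDr tens_scaleDl.

Lemma tens_pi_lin a g h : pi (a *: g + h) = a *: pi g + pi h.
Proof. by rewrite tens_piD -tens_pi_scale. Qed.

Definition tens (u : U) (v : V) : tensor := pi << (u, v) >>.

(* The linear map on the tensor product induced by a map f : U -> V -> W; it is
   independent of the chosen representatives when f is bilinear, see
   tlift_tens and tlift_is_linear. *)
Definition tlift (W : lmodType k) (f : U -> V -> W) (t : tensor) : W :=
  lin (fun p : U * V => f p.1 p.2) (repr t).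

Definition bilinear_map (W : lmodType k) (f : U -> V -> W) : Prop :=
  (forall v, linear (f^~ v)) /\ (forall u, linear (f u)).

Lemma tens_bilinear : bilinear_map tens.
Proof.
by split=> [v a u u'|u a v v']; rewrite /tens -tens_pi_lin; apply/tens_eqP/tens_relP;
  move=> S _ [rS1 rS2]; rewrite opprD addrA.
Qed.

Section Lift.
Variables (W : lmodType k) (f : U -> V -> W).
Hypothesis f_bilin : bilinear_map f.
Local Notation F := (lin (fun p : U * V => f p.1 p.2)).

Lemma tlift_rel g : g \in tens_rel -> F g = 0.
Proof.
move=> /tens_relP/(_ (fun h => F h = 0)); apply=> {g}.
  split=> [|a g h Fg Fh]; first exact: linear0.
  by rewrite linearP /= Fg Fh scaler0 addr0.
split=> [a u u' v|a u v v']; rewrite !linearB linearZ /= !lin_base /=.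
  by rewrite f_bilin.1 addrAC addrK subrr.
by rewrite f_bilin.2 addrAC addrK subrr.
Qed.

Lemma tlift_pi g : tlift f (pi g) = F g.
Proof.
apply/eqP; rewrite -subr_eq0 -linearB; apply/eqP/tlift_rel/tens_eqP.
exact: tens_reprK.
Qed.

Lemma tlift_tens u v : tlift f (tens u v) = f u v.
Proof. by rewrite tlift_pi lin_base. Qed.

Lemma tlift_is_linear : linear (tlift f).
Proof.
move=> a s t; rewrite -[s]tens_reprK -[t]tens_reprK.
by rewrite -tens_pi_lin !tlift_pi linearP.
Qed.

End Lift.
End Tensor.

Arguments tensor {k} U V.

Section TensorMaps.
Variable k : comNzRingType.

Definition tmap (U V U' V' : lmodType k) (f : U -> U') (g : V -> V') :
    tensor U V -> tensor U' V' :=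
  tlift (fun u v => tens (f u) (g v)).

Definition tassoc (U V W : lmodType k) :
    tensor (tensor U V) W -> tensor U (tensor V W) :=
  tlift (fun t w => tlift (fun u v => tens u (tens v w)) t).

(* The componentwise product: (u (x) v)(u' (x) v') = uu' (x) vv'. *)
Definition tmul (U V : lmodType k) (mulU : U -> U -> U) (mulV : V -> V -> V)
    (s t : tensor U V) : tensor U V :=
  tlift (fun u v => tlift (fun u' v' => tens (mulU u u') (mulV v v')) t) s.

End TensorMaps.

Section Bialgebra.
Variable k : comNzRingType.

Record is_algebra (B : lmodType k) (mul : B -> B -> B) (one : B) : Prop :=
  IsAlgebra {
    alg_bilinear : bilinear_map mul;
    alg_mulA : associative mul;
    alg_mul1 : left_id one mul;
    alg_mulr1 : right_id one mul }.

Record is_alg_morphism (B C : lmodType k) (mulB : B -> B -> B) (oneB : B)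
    (mulC : C -> C -> C) (oneC : C) (f : B -> C) : Prop :=
  IsAlgMorphism {
    algm_linear : linear f;
    algm_one : f oneB = oneC;
    algm_mul : forall x y, f (mulB x y) = mulC (f x) (f y) }.

Record is_coalgebra (B : lmodType k) (Delta : B -> tensor B B) (eps : B -> k^o)
    : Prop :=
  IsCoalgebra {
    coalg_Delta_linear : linear Delta;
    coalg_eps_linear : linear eps;
    coalg_coassoc : forall x,
      tassoc (tmap Delta id (Delta x)) = tmap id Delta (Delta x);
    coalg_counitl : forall x, tlift (fun y z => (eps y : k) *: z) (Delta x) = x;
    coalg_counitr : forall x, tlift (fun y z => (eps z : k) *: y) (Delta x) = x }.

Record is_bialgebra (B : lmodType k) (mul : B -> B -> B) (one : B)
    (Delta : B -> tensor B B) (eps : B -> k^o) : Prop :=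
  IsBialgebra {
    bialg_algebra : is_algebra mul one;
    bialg_coalgebra : is_coalgebra Delta eps;
    bialg_Delta : is_alg_morphism mul one (tmul mul mul) (tens one one) Delta;
    bialg_eps : is_alg_morphism mul one ( *%R : k^o -> k^o -> k^o) 1 eps }.

Record is_mRB_morphism (B C : lmodType k)
    (mulB : B -> B -> B) (oneB : B) (PB : B -> B)
    (mulC : C -> C -> C) (oneC : C) (PC : C -> C) (f : B -> C) : Prop :=
  IsMRBMorphism {
    mRBm_alg : is_alg_morphism mulB oneB mulC oneC f;
    mRBm_op : forall x, f (PB x) = PC (f x) }.

End Bialgebra.

(* A basis of A containing 1, as a subset of A: every element of A is a finite
   linear combination of elements of the subset in exactly one way. *)
Record unital_basis (k : comNzRingType) (A : algType k) := UnitalBasis {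
  ub_set :> {pred A};
  ub_one : 1 \in ub_set;
  ub_basis : forall a : A,
    exists! c : {malg k[{x : A | x \in ub_set}]}, lin val c = a }.

Section Coordinates.
Variables (k : comNzRingType) (A : algType k) (X : unital_basis A).

Lemma ub_coord_ex (a : A) :
  exists c : {malg k[{x : A | x \in ub_set X}]}, lin val c == a.
Proof. by have [c [/eqP ca _]] := ub_basis X a; exists c. Qed.

Definition coord (a : A) : {malg k[{x : A | x \in ub_set X}]} :=
  xchoose (ub_coord_ex a).

Lemma coordK a : lin val (coord a) = a.
Proof. exact/eqP/(xchooseP (ub_coord_ex a)). Qed.

End Coordinates.

(* Words on T and brackets, with the bracket pairs kept as a tree: a bracketed
   word is a sequence of atoms, an atom being a letter or a bracketed word
   between brackets. *)
Section Atoms.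
Variable T : choiceType.

Inductive atom : Type := Letter of T | Bracket of seq atom.

Fixpoint atom_enc (a : atom) : GenTree.tree T :=
  match a with
  | Letter x => GenTree.Leaf x
  | Bracket s => GenTree.Node 0 (map atom_enc s)
  end.

Fixpoint atom_dec (t : GenTree.tree T) : atom :=
  match t with
  | GenTree.Leaf x => Letter x
  | GenTree.Node _ s => Bracket (map atom_dec s)
  end.

Lemma atom_encK : cancel atom_enc atom_dec.
Proof.
rewrite /cancel; fix IH 1; case=> [x|s] //=; congr Bracket.
by elim: s => //= a s ->; rewrite IH.
Qed.

HB.instance Definition _ := Choice.copy atom (can_type atom_encK).

Definition is_letter (a : atom) : bool := if a is Letter _ then true else false.

Definition alternating (s : seq atom) : bool :=
  sorted (fun a b => is_letter a != is_letter b) s.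

(* The sets X_n of bracketed words: X_0 consists of the letters and of the empty
   word 1, and X_{n+1} of the words, including 1, that alternate between letters
   and brackets of elements of X_n. *)
Fixpoint stage (n : nat) (s : seq atom) : bool :=
  match n with
  | 0 => (size s <= 1)%N && all is_letter s
  | n.+1 => alternating s &&
            all (fun a => if a is Bracket t then stage n t else true) s
  end.

(* The union of the X_n, see word_okP. *)
Fixpoint atom_ok (a : atom) : bool :=
  match a with
  | Letter _ => true
  | Bracket s => alternating s && all atom_ok s
  end.

Definition word_ok (s : seq atom) : bool := alternating s && all atom_ok s.

Lemma atom_ind_seq (P : atom -> Prop) :
  (forall x, P (Letter x)) ->
  (forall s, (forall a, a \in s -> P a) -> P (Bracket s)) ->
  forall a, P a.
Proof.
move=> PL PB; fix IH 1; case=> [x|s]; first exact: PL.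
apply: PB; elim: s => [|b s IHs] a; first by rewrite in_nil => /notF [].
have Pb := IH b; rewrite in_cons => /predU1P[->|]; [exact: Pb | exact: IHs].
Qed.

Lemma stageS n s : stage n s -> stage n.+1 s.
Proof.
elim: n s => [|n IHn] s.
  by case: s => [|[x|t] [|b s]].
move=> /andP[alt_s /allP ok_s]; apply/andP; split=> //; apply/allP=> a as_.
by move: (ok_s a as_); case: a {as_} => // t; apply: IHn.
Qed.

Lemma stage_mono m n s : (m <= n)%N -> stage m s -> stage n s.
Proof.
move=> /subnK <-; elim: (n - m)%N => // d IHd /IHd.
exact: stageS.
Qed.

Lemma word_okP s : reflect (exists n, stage n s) (word_ok s).
Proof.
apply: (iffP idP) => [|[n]].
  suff stA a : atom_ok a ->
      exists n, (if a is Bracket t then stage n t else true).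
    exact: (stA (Bracket s)).
  elim/atom_ind_seq: a => {s} [x|s0 IHs] ok_a; first by exists 0%N.
  have /andP[alt_s /allP ok_s] := ok_a.
  have [N allN] : exists N,
      all (fun a => if a is Bracket t then stage N t else true) s0.
    elim: s0 IHs ok_s {ok_a alt_s} => [|a s1 IH] IHs ok_s; first by exists 0%N.
    have [||n1 h1] := IHs a; rewrite ?mem_head //.
      by apply: ok_s; rewrite mem_head.
    have [||n2 /allP h2] := IH.
    - by move=> b bs; apply: IHs; rewrite in_cons bs orbT.
    - by move=> b bs; apply: ok_s; rewrite in_cons bs orbT.
    exists (maxn n1 n2); apply/andP; split.
      by case: a h1 {IHs ok_s} => // t; apply: stage_mono; apply: leq_maxl.
    apply/allP=> b bs; move: (h2 b bs); case: b {bs} => // t.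
    by apply: stage_mono; apply: leq_maxr.
  by exists N.+1; apply/andP.
elim: n s => [|n IHn] s; first by case: s => [|[x|t] [|b s]].
move=> /andP[alt_s /allP ok_s]; apply/andP; split=> //; apply/allP=> a as_.
by move: (ok_s a as_); case: a {as_} => // t /IHn.
Qed.

Lemma word_ok_rcons u a : word_ok (rcons u a) -> word_ok u /\ atom_ok a.
Proof.
case/andP; rewrite all_rcons => alt_u /andP[ok_a ok_u]; split=> //.
apply/andP; split=> //; move: alt_u; rewrite /alternating.
by case: u {ok_u} => //= b u; rewrite rcons_path => /andP[].
Qed.

Lemma word_ok_cons a v : word_ok (a :: v) -> atom_ok a /\ word_ok v.
Proof.
case/andP=> /= alt_v /andP[ok_a ok_v]; split=> //; apply/andP; split=> //.
by move: alt_v; rewrite /alternating /=; case: v {ok_v} => //= b v /andP[].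
Qed.

Lemma word_ok_cat u a c v :
  word_ok (rcons u a) -> word_ok (c :: v) -> is_letter a != is_letter c ->
  word_ok (rcons u a ++ c :: v).
Proof.
case/andP=> alt_u ok_u /andP[alt_v ok_v] ac.
rewrite /word_ok all_cat ok_u ok_v andbT; move: alt_u alt_v; rewrite /alternating.
rewrite andbT; case: u {ok_u} => [|b u] /=; first by rewrite ac.
by rewrite cat_path last_rcons => -> alt_v /=; rewrite ac alt_v.
Qed.

Lemma word_ok_join u a b c v :
  word_ok (rcons u a) -> word_ok (c :: v) ->
  is_letter a = is_letter b -> is_letter c = is_letter b -> atom_ok b ->
  word_ok (u ++ b :: v).
Proof.
case/andP=> alt_u; rewrite all_rcons => /andP[_ ok_u] /andP[alt_v /= /andP[_ ok_v]].
move=> ab cb ok_b; rewrite /word_ok all_cat /= ok_u ok_b ok_v !andbT.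
have {alt_v} alt_v : alternating (b :: v).
  by move: alt_v; rewrite /alternating; case: v {ok_v} => //= d v; rewrite cb.
move: alt_u alt_v; rewrite /alternating; case: u {ok_u} => // d u /=.
by rewrite cat_path rcons_path /= => /andP[-> /=]; rewrite ab => -> ->.
Qed.

Record word := Word { wseq :> seq atom; wseqP : word_ok wseq }.
HB.instance Definition _ := [isSub for wseq].
HB.instance Definition _ := [Choice of word by <:].

End Atoms.

(* The free modified Rota-Baxter algebra of weight kappa on A, built on the
   basis X of A. *)
Section FreeMRB.
Variables (k : comNzRingType) (A : algType k) (X : unital_basis A) (kappa : k).

(* X^+ = X \ {1} *)
Definition letter : Type := {x : A | (x \in ub_set X) && (x != 1)}.
HB.instance Definition _ := Choice.on letter.

Definition bword : Type := word letter.
HB.instance Definition _ := Choice.on bword.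

Definition freeMRB : Type := {malg k[bword]}.
HB.instance Definition _ := GRing.Lmodule.on freeMRB.

Definition bone : bword := Word (erefl : word_ok ([::] : seq (atom letter))).

(* The word with a given sequence of atoms. The default value bone is never
   reached below, see word_ok_rcons, word_ok_cons, word_ok_cat, word_ok_join. *)
Definition toword (s : seq (atom letter)) : bword := insubd bone s.

Definition bracket (w : bword) : bword := toword [:: Bracket w].

(* A basis element of A as a word: 1 is the empty word, and the other elements
   are letters. *)
Definition word_of_basis (y : {x : A | x \in ub_set X}) : bword :=
  if insub (val y) is Some x then toword [:: Letter x] else bone.

Definition jA (a : A) : freeMRB :=
  lin (fun y => << word_of_basis y >> : freeMRB) (coord X a).

Definition PA : freeMRB -> freeMRB := lin (fun w => << bracket w >> : freeMRB).

Definition free_one : freeMRB := << bone >>.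

(* The product of two words, by recursion on a strict bound n for their total
   number of letters and bracket pairs (word_size below). Every word occurring
   in a product is at most as large as the two factors together, so the nested
   products also satisfy the bound and the case n = 0 is never reached, see
   dia_rec_bound. *)
Fixpoint dia_rec (n : nat) (w w' : bword) : freeMRB :=
  if n isn't m.+1 then 0 else
  match rev w, wseq w' with
  | [::], _ => << w' >>
  | _, [::] => << w >>
  | a :: ru, a' :: v =>
    let u := rev ru in
    match a, a' with
    | Letter x, Letter x' =>
        lin (fun y => if insub (val y) is Some z
                      then << toword (u ++ Letter z :: v) >> : freeMRB
                      else dia_rec m (toword u) (toword v))
            (coord X (val x * val x'))
    | Bracket t, Bracket t' =>
        let z := toword t in
        let z' := toword t' in
        let lbr y := << toword (u ++ Bracket (wseq y) :: v) >> : freeMRB in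
        lin lbr (dia_rec m (bracket z) z')
        + lin lbr (dia_rec m z (bracket z'))
        + kappa *: bilin (dia_rec m)
                     (bilin (dia_rec m) << toword u >> (dia_rec m z z'))
                     << toword v >>
    | _, _ => << toword (w ++ w') >>
    end
  end.

Fixpoint atom_size (a : atom letter) : nat :=
  match a with
  | Letter _ => 1
  | Bracket s => (sumn (map atom_size s)).+1
  end.

Definition word_size (w : bword) : nat := sumn (map atom_size w).

Definition dia_word (w w' : bword) : freeMRB :=
  dia_rec (word_size w + word_size w').+1 w w'.

Definition dia (g h : freeMRB) : freeMRB := bilin dia_word g h.

(* The recursion equations of the product: dia_1w, dia_w1, dia_mixed,
   dia_letters and dia_brackets. *)
Section Equations.

Let small (N : nat) (g : freeMRB) : Prop :=
  forall y, y \in msupp g -> (word_size y <= N)%N.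

Let smallW M N g : (M <= N)%N -> small M g -> small N g.
Proof. by move=> MN sg y /sg yM; apply: leq_trans MN. Qed.

Let small0 N : small N 0.
Proof. by move=> y; rewrite msupp0 in_fset0. Qed.

Let smallD N g h : small N g -> small N h -> small N (g + h).
Proof.
by move=> sg sh y /(fsubsetP (msuppD_le _ _)); rewrite in_fsetU => /orP[/sg|/sh].
Qed.

Let smallZ N a g : small N g -> small N (a *: g).
Proof. by move=> sg y /(fsubsetP (msuppZ_le _ _))/sg. Qed.

Let smallU N w : (word_size w <= N)%N -> small N << w >>.
Proof. by move=> wN y /(fsubsetP msuppU_le); rewrite in_fset1 => /eqP->. Qed.

Let small_lin (K : choiceType) N (f : K -> freeMRB) (g : {malg k[K]}) :
  (forall y, y \in msupp g -> small N (f y)) -> small N (lin f g).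
Proof.
move=> sf; rewrite /lin big_seq; elim/big_ind: _ => // [g1 g2|y yg].
  exact: smallD.
exact/smallZ/sf.
Qed.

Let seq_size (s : seq (atom letter)) := sumn (map atom_size s).

Let toword_size s : (word_size (toword s) <= seq_size s)%N.
Proof.
by rewrite /toword /insubd; case: insubP => [w _ <-|] /=.
Qed.

Let bracket_size w : (word_size (bracket w) <= (word_size w).+1)%N.
Proof. by apply: leq_trans (toword_size _) _; rewrite /seq_size /= addn0. Qed.

Let seq_size_cat s t : seq_size (s ++ t) = (seq_size s + seq_size t)%N.
Proof. by rewrite /seq_size map_cat sumn_cat. Qed.

Let lin_eq (K : choiceType) (f f' : K -> freeMRB) (g : {malg k[K]}) :
  (forall y, y \in msupp g -> f y = f' y) -> lin f g = lin f' g.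
Proof. by move=> ff'; apply: eq_big_seq => y /ff' ->. Qed.

Lemma bilin_eq (f f' : bword -> bword -> freeMRB) M N g h :
  small M g -> small N h ->
  (forall y z, (word_size y <= M)%N -> (word_size z <= N)%N -> f y z = f' y z) ->
  bilin f g h = bilin f' g h.
Proof.
by move=> sg sh ff'; apply: lin_eq => y /sg yM; apply: lin_eq => z /sh zN; apply: ff'.
Qed.

Let small_bilin (f : bword -> bword -> freeMRB) M N P g h :
  small M g -> small N h ->
  (forall y z, (word_size y <= M)%N -> (word_size z <= N)%N -> small P (f y z)) ->
  small P (bilin f g h).
Proof.
move=> sg sh sf; apply: small_lin => y /sg yM.
by apply: small_lin => z /sh zN; apply: sf.
Qed.

Lemma dia_rec_bound n : forall w w',
  (word_size w + word_size w' < n)%N ->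
  small (word_size w + word_size w') (dia_rec n w w') /\
  (forall m, (word_size w + word_size w' < m)%N ->
     dia_rec m w w' = dia_rec n w w').
Proof.
elim: n => // n IH w w'; rewrite ltnS => le_n.
have smallE w1 w1' N : (word_size w1 + word_size w1' <= N)%N -> (N < n)%N ->
    small N (dia_rec n w1 w1').
  by move=> le_N lt_n; apply/(smallW le_N)/(IH _ _ _).1; lia.
have recE m w1 w1' N : (word_size w1 + word_size w1' <= N)%N -> (N < n)%N ->
    (N < m)%N -> dia_rec m w1 w1' = dia_rec n w1 w1'.
  by move=> le_N lt_n lt_m; apply: (IH _ _ _).2; lia.
have szr : word_size w = seq_size (rev w).
  by rewrite /seq_size map_rev sumn_rev.
suff main m : (word_size w + word_size w' <= m)%N ->
    small (word_size w + word_size w') (dia_rec n.+1 w w') /\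
    dia_rec m.+1 w w' = dia_rec n.+1 w w'.
  by split=> [|[|m]]; [exact: (main n le_n).1 | rewrite ltn0
    | rewrite ltnS => /main[]].
move=> le_m /=.
case: (rev w) szr => [|a ru] sza.
  by split=> //; apply: smallU; lia.
case sw': (wseq w') => [|a' v].
  by split=> //; apply: smallU; lia.
have szu : seq_size (rev ru) = seq_size ru.
  by rewrite /seq_size map_rev sumn_rev.
have sza' : word_size w' = seq_size (a' :: v) by rewrite /word_size sw'.
have tu := toword_size (rev ru); have tv := toword_size v; rewrite szu in tu.
have mixed : small (word_size w + word_size w') << toword (w ++ a' :: v) >>.
  by apply/smallU/(leq_trans (toword_size _)); rewrite seq_size_cat -sza'.
rewrite {1}/seq_size /= -/(seq_size ru) in sza.
rewrite {1}/seq_size /= -/(seq_size v) in sza'.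
case: a a' sza sza' mixed {sw'} => [x|t] [x'|t'] sza sza' mixed;
  [|by split|by split|]; rewrite /= in sza sza'.
  split.
    apply: small_lin => y _; case: insub => [z|].
      apply/smallU/(leq_trans (toword_size _)).
      rewrite seq_size_cat szu {2}/seq_size /= -/(seq_size v); lia.
    by apply: (@smallW (seq_size ru + seq_size v)); [|apply: smallE]; lia.
  apply: lin_eq => y _; case: insub => //.
  by apply: (@recE _ _ _ (seq_size ru + seq_size v)); lia.
rewrite -/(seq_size t) in sza; rewrite -/(seq_size t') in sza'.
have [tt tt'] := (toword_size t, toword_size t').
have [bt bt'] := (bracket_size (toword t), bracket_size (toword t')).
set z := toword t in tt bt *; set z' := toword t' in tt' bt' *.
pose P := (seq_size t + seq_size t')%N.
have s1 : small P.+1 (dia_rec n (bracket z) z') by apply: smallE; lia.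
have s2 : small P.+1 (dia_rec n z (bracket z')) by apply: smallE; lia.
have s3 : small P (dia_rec n z z') by apply: smallE; lia.
have su := @smallU (seq_size ru) (toword (rev ru)) tu.
have sv := @smallU (seq_size v) (toword v) tv.
have s4 : small (seq_size ru + P) (bilin (dia_rec n) << toword (rev ru) >>
    (dia_rec n z z')).
  by apply: small_bilin su s3 _ => y y' yM y'N; apply: smallE; lia.
have slin g : small P.+1 g -> small (word_size w + word_size w')
    (lin (fun y : bword => << toword (rev ru ++ Bracket (wseq y) :: v) >> : freeMRB) g).
  move=> sg; apply: small_lin => y /sg yP; apply/smallU/(leq_trans (toword_size _)).
  rewrite seq_size_cat szu {2}/seq_size /= -/(seq_size v) -/(word_size y).
  lia.
split.
  apply: smallD; first by apply: smallD; exact: slin.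
  apply: smallZ; apply: small_bilin s4 sv _ => y y' yM y'N.
  by apply: (@smallW (seq_size ru + P + seq_size v)); [|apply: smallE]; lia.
have -> : dia_rec m (bracket z) z' = dia_rec n (bracket z) z'.
  by apply: (@recE _ _ _ P.+1); lia.
have -> : dia_rec m z (bracket z') = dia_rec n z (bracket z').
  by apply: (@recE _ _ _ P.+1); lia.
have -> : dia_rec m z z' = dia_rec n z z' by apply: (@recE _ _ _ P); lia.
have <- : bilin (dia_rec n) << toword (rev ru) >> (dia_rec n z z') =
          bilin (dia_rec m) << toword (rev ru) >> (dia_rec n z z').
  apply: bilin_eq su s3 _ => y y' yM y'N; apply/esym.
  by apply: (@recE _ _ _ (seq_size ru + P)); lia.
congr (_ + _ *: _); apply: bilin_eq s4 sv _ => y y' yM y'N.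
by apply: (@recE _ _ _ (seq_size ru + P + seq_size v)); lia.
Qed.

Lemma dia_recE m w w' :
  (word_size w + word_size w' < m)%N -> dia_rec m w w' = dia_word w w'.
Proof. by case: (dia_rec_bound (leqnn (word_size w + word_size w').+1)) => _; apply. Qed.

Lemma dia_rec_dia m g h M N : small M g -> small N h -> (M + N < m)%N ->
  bilin (dia_rec m) g h = dia g h.
Proof.
move=> sg sh lt_m; apply: bilin_eq sg sh _ => y z yM zN.
by apply: dia_recE; lia.
Qed.

Lemma dia_base w w' : dia << w >> << w' >> = dia_word w w'.
Proof. by rewrite /dia /bilin !lin_base. Qed.

Lemma dia_1w w : dia free_one << w >> = << w >>.
Proof. by rewrite dia_base. Qed.

Lemma dia_w1 w : dia << w >> free_one = << w >>.
Proof.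
rewrite dia_base /dia_word [dia_rec _ _ _]/=; case Ew: (rev w) => [|a ru] //.
by congr << _ >>; apply/val_inj; rewrite /= -[wseq w]revK Ew.
Qed.

Lemma dia_mixed w w' u a a' v :
  wseq w = rcons u a -> wseq w' = a' :: v -> is_letter a != is_letter a' ->
  dia << w >> << w' >> = << toword (w ++ w') >>.
Proof.
move=> Ew Ew'; rewrite dia_base /dia_word [dia_rec _ _ _]/= {1}Ew rev_rcons Ew'.
by case: a a' {Ew Ew'} => [x|t] [x'|t'].
Qed.

Let size_rcons w u a : wseq w = rcons u a ->
  word_size w = (seq_size u + atom_size a)%N.
Proof. by rewrite /word_size => ->; rewrite map_rcons sumn_rcons. Qed.

Let size_cons w a v : wseq w = a :: v ->
  word_size w = (atom_size a + seq_size v)%N.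
Proof. by rewrite /word_size => ->. Qed.

Lemma dia_letters w w' u x x' v :
  wseq w = rcons u (Letter x) -> wseq w' = Letter x' :: v ->
  dia << w >> << w' >> =
    lin (fun y => if insub (val y) is Some z
                  then << toword (u ++ Letter z :: v) >> : freeMRB
                  else dia << toword u >> << toword v >>)
        (coord X (val x * val x')).
Proof.
move=> Ew Ew'; rewrite !dia_base /dia_word [dia_rec _ _ _]/= {1}Ew rev_rcons {1}Ew' revK.
have [] := (size_rcons Ew, size_cons Ew'); rewrite [atom_size _]/= => sw sw'.
have [tu tv] := (toword_size u, toword_size v).
apply: lin_eq => y _; case: insub => //.
by rewrite dia_recE //; lia.
Qed.

Lemma dia_brackets w w' u t t' v :
  wseq w = rcons u (Bracket t) -> wseq w' = Bracket t' :: v ->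
  let z := toword t in
  let z' := toword t' in
  let lbr y := << toword (u ++ Bracket (wseq y) :: v) >> : freeMRB in
  dia << w >> << w' >> =
    lin lbr (dia << bracket z >> << z' >>) + lin lbr (dia << z >> << bracket z' >>)
    + kappa *: dia (dia << toword u >> (dia << z >> << z' >>)) << toword v >>.
Proof.
move=> Ew Ew' z z' lbr.
have [] := (size_rcons Ew, size_cons Ew'); rewrite [atom_size _]/=.
rewrite [atom_size (Bracket _)]/= -/(seq_size t) -/(seq_size t') => sw sw'.
have [tt tt'] := (toword_size t, toword_size t'); rewrite -/z -/z' in tt tt'.
have [tu tv] := (toword_size u, toword_size v).
have [bt bt'] := (bracket_size z, bracket_size z').
rewrite (dia_base w w') /dia_word [dia_rec _ _ _]/= {1}Ew rev_rcons {1}Ew' revK.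
rewrite -/z -/z' !dia_base.
have recE x x' : (word_size x + word_size x' < word_size w + word_size w')%N ->
    dia_rec (word_size w + word_size w') x x' = dia_word x x'.
  exact: dia_recE.
rewrite !recE; try lia.
pose P := (seq_size t + seq_size t')%N.
have s3 : small P (dia_word z z').
  apply: (@smallW (word_size z + word_size z')); first by lia.
  by have [] := @dia_rec_bound _ z z' (leqnn _).
have su := @smallU (seq_size u) (toword u) tu.
have sv := @smallU (seq_size v) (toword v) tv.
congr (_ + _ *: _); rewrite (dia_rec_dia su s3); last by lia.
apply: (@dia_rec_dia _ _ _ (seq_size u + P) (seq_size v)) => //; last by lia.
rewrite /dia; apply: small_bilin su s3 _ => y y' yM y'N.
apply: (@smallW (word_size y + word_size y')); first by lia.
by have [] := @dia_rec_bound _ y y' (leqnn _).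
Qed.

End Equations.

End FreeMRB.

(* The maps of the bialgebra structure on the free modified Rota-Baxter algebra
   of weight - lambda ^ 2. *)
Section Structure.
Variables (k : comNzRingType) (A : algType k) (X : unital_basis A) (lambda : k).

Local Notation F := (freeMRB X).
Local Notation kappa := (- lambda ^+ 2).

Definition is_epsM (epsA : A -> k^o) (epsM : F -> k^o) : Prop :=
  is_mRB_morphism (dia kappa) (free_one X) (@PA k A X)
    ( *%R : k^o -> k^o -> k^o) 1 (fun c : k^o => (- lambda) *: c) epsM
  /\ forall a, epsM (jA X a) = epsA a.

Definition QM (epsM : F -> k^o) : tensor F F -> tensor F F :=
  tlift (fun u v => tens (PA u + lambda *: u) ((epsM v : k) *: free_one X)
                    + tens u (PA v)).

Definition is_DeltaM (DeltaA : A -> tensor A A) (epsM : F -> k^o)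
    (DeltaM : F -> tensor F F) : Prop :=
  is_mRB_morphism (dia kappa) (free_one X) (@PA k A X)
    (tmul (dia kappa) (dia kappa)) (tens (free_one X) (free_one X)) (QM epsM)
    DeltaM
  /\ forall a, DeltaM (jA X a) = tmap (jA X) (jA X) (DeltaA a).

End Structure.

(* f is the only map satisfying P. *)
Definition is_the (T U : Type) (P : (T -> U) -> Prop) (f : T -> U) : Prop :=
  P f /\ forall g, P g -> g =1 f.

(* Main.v *)
Require Import Defs.
From mathcomp Require Import all_boot all_order all_algebra.
From mathcomp Require Import generic_quotient finmap.
From mathcomp.multinomials Require Import monalg.
From mathcomp Require Import zify ring.

(* Associativity of dia. Let x = u a and z = c v be words with last atom a and
   first atom c. The recursion says that x * z = (u * (a * c)) * v; if a and c
   are of the same kind, a * c is a combination of 1 and of atoms of that kind,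
   plus (for brackets a = P s, c = P t) the part kappa s * t of smaller size. By
   induction on the total size, and then on the number of atoms of the middle
   factor, (x * y) * z = x * (y * z) reduces to the case of three single atoms of
   the same kind. For letters this is associativity in A; for brackets it follows
   from the modified Rota-Baxter identity by expanding
   P g = P s * P t - kappa s * t with g = P s * t + s * P t.

   The bialgebra. The operator P + lambda is a Rota-Baxter operator of weight
   - 2 lambda, killed by epsM; hence QM is a modified Rota-Baxter operator, and
   DeltaM and epsM come from the universal property. F is generated by jA(A)
   under its product and P, so the counit laws and coassociativity only have to be
   checked for compatibility with products and with P. For coassociativity, both
   iterated coproducts intertwine P with one and the same operator of
   F (x) (F (x) F). *)

Set Implicit Arguments.
Unset Strict Implicit.
Unset Printing Implicit Defensive.

Import GRing.Theory.
Local Open Scope ring_scope.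

(** * Linear maps, free modules and tensor products *)

Section LinearProp.
Variable k : comNzRingType.
Implicit Types U V W : lmodType k.

Lemma linear_at0 U V (f : U -> V) : linear f -> f 0 = 0.
Proof. by move=> lf; have := lf (-1) 0 0; rewrite scaler0 addr0 scaleN1r addNr. Qed.

Lemma linear_atZ U V (f : U -> V) : linear f -> forall a u, f (a *: u) = a *: f u.
Proof. by move=> lf a u; have := lf a u 0; rewrite !addr0 (linear_at0 lf) addr0. Qed.

Lemma linear_atD U V (f : U -> V) : linear f -> {morph f : u v / u + v}.
Proof. by move=> lf u v; have := lf 1 u v; rewrite !scale1r. Qed.

Lemma linear_comp U V W (f : V -> W) (g : U -> V) :
  linear f -> linear g -> linear (fun u => f (g u)).
Proof. by move=> lf lg a u v; rewrite lg lf. Qed.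

Lemma linear_add U V (f g : U -> V) :
  linear f -> linear g -> linear (fun u => f u + g u).
Proof. by move=> lf lg a u v; rewrite lf lg scalerDr addrACA. Qed.

Lemma linear_scale U V (c : k) (f : U -> V) : linear f -> linear (fun u => c *: f u).
Proof. by move=> lf a u v; rewrite lf scalerDr !scalerA mulrC. Qed.

Lemma linear_scale_vec U V (f : U -> k^o) (v : V) :
  linear f -> linear (fun u => (f u : k) *: v).
Proof. by move=> lf a u u'; rewrite lf scalerDl scalerA. Qed.

Lemma linear_id U : linear (@id U). Proof. by []. Qed.

(** A bare predicate, because it serves as the motive of span inductions, most often as an equality
    of two linear maps. *)
Definition submodule U (S : U -> Prop) : Prop :=
  S 0 /\ forall a u v, S u -> S v -> S (a *: u + v).

(** This reduces an identity between linear maps to a spanning set, one variable at a time. *)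
Lemma equalizer_submodule U V (f g : U -> V) :
  linear f -> linear g -> submodule (fun u => f u = g u).
Proof.
move=> lf lg; split; first by rewrite (linear_at0 lf) (linear_at0 lg).
by move=> a u v fgu fgv; rewrite lf lg fgu fgv.
Qed.

Lemma submodule_sum U (S : U -> Prop) (I : eqType) (r : seq I) (c : I -> k)
    (F : I -> U) : submodule S -> (forall i, i \in r -> S (F i)) ->
  S (\sum_(i <- r) c i *: F i).
Proof.
move=> [S0 SP]; elim: r => [|i r IH] SF; first by rewrite big_nil.
rewrite big_cons; apply: SP; first by apply: SF; rewrite mem_head.
by apply: IH => j jr; apply: SF; rewrite in_cons jr orbT.
Qed.

Lemma bilinear_submodule U V W (f : U -> V -> W) (S : W -> Prop) :
  bilinear_map f -> submodule S ->
  (forall v, submodule (fun u => S (f u v))) /\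
  (forall u, submodule (fun v => S (f u v))).
Proof.
move=> [fl fr] [S0 SP]; split=> [v|u].
  by split=> [|a u u' Su Su']; rewrite ?(linear_at0 (fl v)) ?fl //; apply: SP.
by split=> [|a v v' Sv Sv']; rewrite ?(linear_at0 (fr u)) ?fr //; apply: SP.
Qed.

Section FreeModuleSpan.
Variable K : choiceType.
Implicit Types g h : {malg k[K]}.

Lemma malg_sum g : g = \sum_(x <- msupp g) g@_x *: << x >>.
Proof.
rewrite {1}[g]monalgE; apply: eq_bigr => x _; apply/malgP => y.
by rewrite mcoeffZ !mcoeffU mulrnAr mulr1.
Qed.

Lemma malg_span (S : {malg k[K]} -> Prop) g :
  submodule S -> (forall x, x \in msupp g -> S << x >>) -> S g.
Proof. by move=> mS Sg; rewrite [g]malg_sum; apply: submodule_sum. Qed.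

Lemma lin_span V (S : V -> Prop) (f : K -> V) g :
  submodule S -> (forall x, x \in msupp g -> S (f x)) -> S (lin f g).
Proof. exact: submodule_sum. Qed.

End FreeModuleSpan.

Lemma bilin_bilinear (K L : choiceType) V (f : K -> L -> V) :
  bilinear_map (bilin f).
Proof.
split=> [h|g] a u v; first exact: linearP.
rewrite /bilin /lin scaler_sumr -big_split; apply: eq_bigr => x _ /=.
by rewrite -/(lin _ _) -/(lin _ _) -/(lin _ _) linearP scalerDr !scalerA mulrC.
Qed.

End LinearProp.

(** * Maps out of tensor products, and the tensor product of algebras *)

Section TensorProp.
Local Open Scope quotient_scope.
Variable k : comNzRingType.
Implicit Types U V W : lmodType k.

Lemma tens_linl U V (v : V) : linear (fun u : U => tens u v).
Proof. exact: (tens_bilinear U V).1. Qed.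

Lemma tens_linr U V (u : U) : linear (fun v : V => tens u v).
Proof. exact: (tens_bilinear U V).2. Qed.

(** A tensor is the class of a finite formal combination of pairs, so [malg_span] applies to the
    preimage of [S] in the free module. *)
Lemma tens_span U V (S : tensor U V -> Prop) :
  submodule S -> (forall u v, S (tens u v)) -> forall t, S t.
Proof.
move=> [S0 SP] St t; rewrite -[t]tens_reprK.
set pi := \pi_(_) : {malg k[(U * V)%type]} -> _.
suff Spi g : S (pi g) by [].
apply: (@malg_span _ _ (fun g => S (pi g))) => [|[u v] _]; last exact: St.
split=> [|a h h' Sh Sh'].
  by suff -> : pi 0 = 0 :> tensor U V by []; apply: raddf0.
by have := SP a _ _ Sh Sh'; rewrite -tens_pi_lin.
Qed.

Lemma tens_ext U V W (f g : tensor U V -> W) :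
  linear f -> linear g -> (forall u v, f (tens u v) = g (tens u v)) -> f =1 g.
Proof. by move=> lf lg; apply: tens_span; apply: equalizer_submodule. Qed.

(** Linearity in the parameter can be tested on pure tensors. This handles nested lifts such as
    those in [tassoc] and [tmul]. *)
Lemma tlift_bilinear (T U V W : lmodType k) (f : T -> U -> V -> W) :
  (forall t, bilinear_map (f t)) -> (forall u v, linear (fun t => f t u v)) ->
  bilinear_map (fun t => tlift (f t)).
Proof.
move=> bf lf; split=> [s|t]; last exact: tlift_is_linear.
move=> a t t'; move: s; apply: tens_ext => [||u v].
- exact/tlift_is_linear/bf.
- by apply: linear_add; [apply: linear_scale|]; apply/tlift_is_linear/bf.
- by rewrite !(tlift_tens (bf _)) lf.
Qed.

Lemma bilinear_comp U V U' V' W (f : U' -> V' -> W) (g : U -> U') (h : V -> V') :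
  bilinear_map f -> linear g -> linear h -> bilinear_map (fun u v => f (g u) (h v)).
Proof.
move=> [fl fr] lg lh; split=> [v|u]; first exact: (linear_comp (fl _) lg).
exact: (linear_comp (fr _) lh).
Qed.

Lemma bilinear_tens U V U' V' (f : U -> U') (g : V -> V') :
  linear f -> linear g -> bilinear_map (fun u v => tens (f u) (g v)).
Proof. exact/bilinear_comp/tens_bilinear. Qed.

Lemma bilinear_add U V W (f g : U -> V -> W) :
  bilinear_map f -> bilinear_map g -> bilinear_map (fun u v => f u v + g u v).
Proof.
move=> [fl fr] [gl gr]; split=> [v|u]; first exact: (linear_add (fl v) (gl v)).
exact: (linear_add (fr u) (gr u)).
Qed.

Lemma linear_bilinear (U V W T : lmodType k) (f : W -> T) (g : U -> V -> W) :
  linear f -> bilinear_map g -> bilinear_map (fun u v => f (g u v)).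
Proof.
by move=> lf [gl gr]; split=> [v|u];
  [apply: (linear_comp lf (gl v)) | apply: (linear_comp lf (gr u))].
Qed.

Section Maps.
Variables (U V U' V' : lmodType k) (f : U -> U') (g : V -> V').
Hypotheses (lf : linear f) (lg : linear g).

Lemma tmap_linear : linear (tmap f g).
Proof. exact/tlift_is_linear/bilinear_tens. Qed.

Lemma tmap_tens u v : tmap f g (tens u v) = tens (f u) (g v).
Proof. exact/tlift_tens/bilinear_tens. Qed.

End Maps.

Lemma tassoc_bilin U V W : bilinear_map (fun (t : tensor U V) (w : W) =>
  tlift (fun u v => tens u (tens v w)) t).
Proof.
have b (w : W) : bilinear_map (fun (u : U) (v : V) => tens u (tens v w)).
  by apply: bilinear_tens; [apply: linear_id | apply: tens_linl].
split=> [w|t]; first exact: tlift_is_linear.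
refine ((tlift_bilinear b _).1 t) => u v.
exact: (linear_comp (tens_linr u) (tens_linr v)).
Qed.

Lemma tassoc_linear U V W : linear (@tassoc k U V W).
Proof. exact/tlift_is_linear/tassoc_bilin. Qed.

Lemma tassoc_tens U V W (u : U) (v : V) (w : W) :
  tassoc (tens (tens u v) w) = tens u (tens v w).
Proof.
rewrite /tassoc tlift_tens; last exact: tassoc_bilin.
apply: tlift_tens; apply: bilinear_tens; first exact: linear_id.
exact: tens_linl.
Qed.

Section Product.
Variables (U V : lmodType k) (mulU : U -> U -> U) (mulV : V -> V -> V).
Hypotheses (bU : bilinear_map mulU) (bV : bilinear_map mulV).

Let b1 u v : bilinear_map (fun u' v' => tens (mulU u u') (mulV v v')).
Proof. by apply: bilinear_tens; [apply: bU.2 | apply: bV.2]. Qed.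

Let b2 t : bilinear_map
  (fun u v => tlift (fun u' v' => tens (mulU u u') (mulV v v')) t).
Proof.
split=> [v|u].
  refine ((tlift_bilinear (fun u => b1 u v) _).1 t) => u' v'.
  exact: (linear_comp (tens_linl _) (bU.1 _)).
refine ((tlift_bilinear (b1 u) _).1 t) => u' v'.
exact: (linear_comp (tens_linr _) (bV.1 _)).
Qed.

Lemma tmul_bilinear : bilinear_map (tmul mulU mulV).
Proof.
split=> [t|s]; first exact/tlift_is_linear/b2.
refine ((tlift_bilinear b2 _).1 s) => u v.
exact/tlift_is_linear/b1.
Qed.

Lemma tmul_tens u v u' v' :
  tmul mulU mulV (tens u v) (tens u' v') = tens (mulU u u') (mulV v v').
Proof. by rewrite /tmul tlift_tens //; apply: tlift_tens. Qed.

End Product.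

Lemma tmul_algebra U V (mulU : U -> U -> U) (mulV : V -> V -> V) oneU oneV :
  is_algebra mulU oneU -> is_algebra mulV oneV ->
  is_algebra (tmul mulU mulV) (tens oneU oneV).
Proof.
move=> [bU aU lU rU] [bV aV lV rV]; have b := tmul_bilinear bU bV.
have E := tmul_tens bU bV; apply: IsAlgebra.
- exact: b.
- move=> s t r.
  move: s; apply: tens_span => [|u v].
    apply: equalizer_submodule; first exact: b.1.
    exact: linear_comp (b.1 _) (b.1 _).
  move: t; apply: tens_span => [|u' v'].
    apply: equalizer_submodule; first exact: linear_comp (b.2 _) (b.1 _).
    exact: linear_comp (b.1 _) (b.2 _).
  move: r; apply: tens_span => [|u'' v'']; last by rewrite !E aU aV.
  apply: equalizer_submodule; last exact: b.2.
  exact: linear_comp (b.2 _) (b.2 _).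
- apply: tens_ext => [||u v]; [exact: b.2 | exact: linear_id|].
  by rewrite E lU lV.
- apply: tens_ext => [||u v]; [exact: b.1 | exact: linear_id|].
  by rewrite E rU rV.
Qed.

Lemma tmap_alg_morphism (U V U' V' : lmodType k) mU oU mV oV mU' oU' mV' oV'
    (f : U -> U') (g : V -> V') :
  is_algebra mU oU -> is_algebra mV oV -> is_algebra mU' oU' -> is_algebra mV' oV' ->
  is_alg_morphism mU oU mU' oU' f -> is_alg_morphism mV oV mV' oV' g ->
  is_alg_morphism (tmul mU mV) (tens oU oV) (tmul mU' mV') (tens oU' oV') (tmap f g).
Proof.
move=> [bU _ _ _] [bV _ _ _] [bU' _ _ _] [bV' _ _ _] [lf f1 fM] [lg g1 gM].
have lfg := tmap_linear lf lg; split; [exact: lfg | by rewrite tmap_tens // f1 g1|].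
have [b b'] := (tmul_bilinear bU bV, tmul_bilinear bU' bV').
move=> s t; move: s; apply: tens_span => [|u v].
  apply: equalizer_submodule; first exact: linear_comp (b.1 _).
  exact: linear_comp (b'.1 _) lfg.
move: t; apply: tens_span => [|u' v'].
  apply: equalizer_submodule; first exact: linear_comp (b.2 _).
  exact: linear_comp (b'.2 _) lfg.
rewrite (tmul_tens bU bV) !(tmap_tens lf lg) fM gM.
by rewrite (tmul_tens bU' bV').
Qed.

Lemma tassoc_alg_morphism (U V W : lmodType k) mU oU mV oV mW oW :
  is_algebra mU oU -> is_algebra mV oV -> is_algebra mW oW ->
  is_alg_morphism (tmul (tmul mU mV) mW) (tens (tens oU oV) oW)
    (tmul mU (tmul mV mW)) (tens oU (tens oV oW)) (@tassoc k U V W).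
Proof.
move=> aU aV aW; have [bU _ _ _] := aU; have [bV _ _ _] := aV.
have [bW _ _ _] := aW.
have [bUV bVW] := (tmul_bilinear bU bV, tmul_bilinear bV bW).
have [b b'] := (tmul_bilinear bUV bW, tmul_bilinear bU bVW).
have la := @tassoc_linear U V W.
split; [exact: la | exact: tassoc_tens|].
move=> s t; move: s; apply: tens_span => [|s w].
  apply: equalizer_submodule; first exact: linear_comp (b.1 _).
  exact: linear_comp (b'.1 _) la.
move: s; apply: tens_span => [|u v].
  apply: equalizer_submodule.
    exact: linear_comp la (linear_comp (b.1 _) (tens_linl _)).
  exact: linear_comp (b'.1 _) (linear_comp la (tens_linl _)).
move: t; apply: tens_span => [|t w'].
  apply: equalizer_submodule; first exact: linear_comp (b.2 _).
  exact: linear_comp (b'.2 _) la.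
move: t; apply: tens_span => [|u' v'].
  apply: equalizer_submodule.
    exact: linear_comp la (linear_comp (b.2 _) (tens_linl _)).
  exact: linear_comp (b'.2 _) (linear_comp la (tens_linl _)).
(* Generalizing tens, tmul and tassoc keeps the rewriting from unfolding them. *)
have E1 := tmul_tens bUV bW (tens u v) w (tens u' v') w'.
have E2 := tmul_tens bU bV u v u' v'.
have E3 := tmul_tens bU bVW u (tens v w) u' (tens v' w').
have E4 := tmul_tens bV bW v w v' w'.
move: E1 E2 E3 E4 (@tassoc_tens U V W); move: (@tens k) (@tmul k) (@tassoc k).
by move=> te mu ta E1 E2 E3 E4 E5; rewrite E1 E2 !E5 E3 E4.
Qed.

End TensorProp.

(** * The product on words *)

Section Words.
Variables (k : comNzRingType) (A : algType k) (X : unital_basis A).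

Local Notation F := (freeMRB X).
Local Notation L := (atom (letter X)).
Local Notation W s := (<< toword s >> : F).

Lemma towordK (s : seq L) : word_ok s -> toword s = s :> seq L.
Proof. by move=> ok_s; rewrite /toword val_insubd ok_s. Qed.

Lemma wseqK (w : bword X) : toword w = w.
Proof. by apply/val_inj/towordK/wseqP. Qed.

Lemma toword_nil : W [::] = free_one X.
Proof. by congr << _ >>; apply/val_inj; rewrite /= towordK. Qed.

Lemma word_ok1 (a : L) : word_ok [:: a] = atom_ok a.
Proof. by rewrite /word_ok /= andbT. Qed.

Lemma word_ok_catl (s1 s2 : seq L) : word_ok (s1 ++ s2) -> word_ok s1.
Proof.
elim/last_ind: s2 => [|s2 a IH]; first by rewrite cats0.
by rewrite -rcons_cat => /word_ok_rcons[/IH].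
Qed.

Lemma word_ok_catr (s1 s2 : seq L) : word_ok (s1 ++ s2) -> word_ok s2.
Proof. by elim: s1 => //= a s1 IH /word_ok_cons[_ /IH]. Qed.

(** [coord] is a chosen family of coordinates, but [ub_basis] leaves only one choice; linearity of
    [coord] follows from this. *)
Lemma coord_unique (a : A) c : lin val c = a -> Defs.coord X a = c.
Proof.
move=> ca; have [c0 [_ uc]] := ub_basis X a.
by rewrite -(uc _ ca); apply/esym/uc/coordK.
Qed.

Lemma coord_val (y : {x : A | x \in ub_set X}) : Defs.coord X (val y) = << y >>.
Proof. by apply: coord_unique; rewrite lin_base. Qed.

Lemma coord_linear : linear (Defs.coord X).
Proof. by move=> c a b; apply: coord_unique; rewrite linearP /= !coordK. Qed.

Lemma jA_linear : linear (jA X).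
Proof. by move=> c a b; rewrite /jA coord_linear linearP. Qed.

Lemma jA_letter (x : letter X) : jA X (val x) = W [:: Letter x].
Proof.
case: x => x x_ok; have [xX x1] := andP x_ok.
rewrite /jA (coord_val (Sub x xX)) lin_base /word_of_basis.
case: insubP => [y _ yx|]; last by rewrite /= x_ok.
by congr << toword [:: Letter _] >>; apply: val_inj.
Qed.

Lemma jA1 : jA X 1 = free_one X.
Proof.
rewrite /jA (coord_val (Sub 1 (ub_one X))) lin_base /word_of_basis.
by case: insubP => //= y; rewrite eqxx andbF.
Qed.

Lemma basis_span (S : A -> Prop) :
  submodule S -> S 1 -> (forall x : letter X, S (val x)) -> forall a, S a.
Proof.
move=> mS S1 Sx a; rewrite -(coordK X a); apply: lin_span => // -[x xX] _ /=.
have [->//|x1] := eqVneq x 1.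
by have := Sx (Sub x (introT andP (conj xX x1))).
Qed.

Lemma PA_linear : linear (@PA k A X).
Proof. exact: linearP. Qed.

Lemma PA_word (s : seq L) : word_ok s -> PA (W s) = W [:: Bracket s].
Proof. by move=> ok_s; rewrite /PA lin_base /bracket towordK. Qed.

Lemma words_span (S : F -> Prop) :
  submodule S -> (forall s, word_ok s -> S (W s)) -> forall g, S g.
Proof.
move=> mS Sw g; apply: malg_span => // w _.
by rewrite -(wseqK w); apply/Sw/wseqP.
Qed.

(** * The filtration by word size *)

Definition seq_size (s : seq L) : nat := sumn (map (@atom_size _ _ X) s).

Lemma seq_size_cat s t : seq_size (s ++ t) = (seq_size s + seq_size t)%N.
Proof. by rewrite /seq_size map_cat sumn_cat. Qed.

Lemma seq_size_cons a t : seq_size (a :: t) = (atom_size a + seq_size t)%N.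
Proof. by []. Qed.

Lemma seq_size_rcons s a : seq_size (rcons s a) = (seq_size s + atom_size a)%N.
Proof. by rewrite -cats1 seq_size_cat /seq_size /= addn0. Qed.

Lemma atom_size_bracket s : atom_size (Bracket s) = (seq_size s).+1.
Proof. by []. Qed.

Lemma atom_size_gt0 (a : L) : (0 < atom_size a)%N.
Proof. by case: a. Qed.

Definition small (N : nat) (g : F) : Prop :=
  forall y, y \in msupp g -> (word_size y <= N)%N.

Lemma small_submodule N : submodule (small N).
Proof.
split=> [y|a u v su sv y]; first by rewrite msupp0 in_fset0.
move/(fsubsetP (msuppD_le _ _)); rewrite in_fsetU => /orP[|/sv//].
by move/(fsubsetP (msuppZ_le _ _))/su.
Qed.

Lemma small_leq M N g : (M <= N)%N -> small M g -> small N g.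
Proof. by move=> MN sg y /sg yM; apply: leq_trans MN. Qed.

Lemma small_base w : small (word_size w) << w >>.
Proof. by move=> y /(fsubsetP msuppU_le); rewrite in_fset1 => /eqP->. Qed.

Lemma small_word s : word_ok s -> small (seq_size s) (W s).
Proof. by move=> ok_s; have := @small_base (toword s); rewrite /word_size towordK. Qed.

Lemma small_span (S : F -> Prop) N g : submodule S ->
  (forall s, word_ok s -> (seq_size s <= N)%N -> S (W s)) -> small N g -> S g.
Proof.
move=> mS Sw sg; apply: malg_span => // w /sg wN.
by rewrite -(wseqK w); apply: Sw wN; apply/wseqP.
Qed.

Lemma smallP N g : small N g -> small N.+1 (PA g).
Proof.
apply: (small_span (S := fun g => small N.+1 (PA g))) => [|s ok_s sN].
  have [S0 SP] := small_submodule N.+1.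
  split=> [|a u v su sv]; first by rewrite (linear_at0 PA_linear).
  by rewrite PA_linear; apply: SP.
rewrite PA_word //; apply: small_leq (small_word _); last by rewrite word_ok1.
by rewrite seq_size_cons atom_size_bracket addn0.
Qed.

(** * The product of words, with its recursion written through [jA], [PA] and [dia] alone *)

Variable kappa : k.
Local Notation "g ** h" := (dia kappa g h) (at level 40, left associativity).

Lemma dia_bilinear : bilinear_map (@dia k A X kappa).
Proof. exact: bilin_bilinear. Qed.

Let dial h : linear (fun g => g ** h) := dia_bilinear.1 h.
Let diar g : linear (fun h => g ** h) := dia_bilinear.2 g.

Lemma dia_1g g : free_one X ** g = g.
Proof.
move: g; apply: words_span => [|s _]; last exact: dia_1w.
by apply: equalizer_submodule; first exact: diar.
Qed.

Lemma dia_g1 g : g ** free_one X = g.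
Proof.
move: g; apply: words_span => [|s _]; last exact: dia_w1.
by apply: equalizer_submodule; first exact: dial.
Qed.

(** On words this is the size bound of [dia_rec_bound]; bilinearity gives the rest. *)
Lemma small_dia M N g h : small M g -> small N h -> small (M + N) (g ** h).
Proof.
have [bl br] := bilinear_submodule dia_bilinear (small_submodule (M + N)).
move=> sg sh; apply: (small_span (bl h) _ sg) => s ok_s sM.
apply: (small_span (br (W s)) _ sh) => s' ok_s' sN.
rewrite dia_base; apply: (@small_leq (seq_size s + seq_size s')); first exact: leq_add.
have [sm _] := @dia_rec_bound _ _ _ kappa _ (toword s) (toword s') (leqnn _).
by move=> y /sm; rewrite {2 3}/word_size !towordK.
Qed.

(** If neither word is empty, alternation puts two atoms of different kinds at the junction, which
    is the concatenation case of the recursion. *)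
Lemma dia_cat (s1 s2 : seq L) : word_ok (s1 ++ s2) -> W s1 ** W s2 = W (s1 ++ s2).
Proof.
elim/last_ind: s1 => [|u a _]; first by rewrite toword_nil dia_1g.
case: s2 => [|b v]; first by rewrite toword_nil dia_g1 cats0.
move=> ok; have [okl okr] := (word_ok_catl ok, word_ok_catr ok).
rewrite (dia_mixed _ (towordK okl) (towordK okr)) ?towordK //.
case/andP: ok; rewrite /alternating; case: u {okl} => /= [|c u].
  by case/andP.
by rewrite cat_path last_rcons => /andP[_ /= /andP[]].
Qed.

Lemma lin_image (K : choiceType) (U V : lmodType k) (phi : U -> V) (f : K -> U) h :
  linear phi -> phi (lin f h) = lin (fun y => phi (f y)) h.
Proof.
move=> lphi; apply: (malg_span
  (S := fun h => phi (lin f h) = lin (fun y => phi (f y)) h)).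
  apply: equalizer_submodule; last exact: linearP.
  by apply: linear_comp => //; apply: linearP.
by move=> y _; rewrite !lin_base.
Qed.

Lemma lin_ext (K : choiceType) (V : lmodType k) (f f' : K -> V) h :
  f =1 f' -> lin f h = lin f' h.
Proof. by move=> ff'; apply: eq_bigr => x _; rewrite ff'. Qed.

(** The recursion treats the unit and the letters occurring in the product of [x] and [x']
    separately; both outcomes are values of one linear map, [g |-> (W u ** g) ** W v], by [dia_cat]
    in the case of a letter. *)
Lemma dia_join_letters u x x' v :
  word_ok (rcons u (Letter x)) -> word_ok (Letter x' :: v) ->
  W (rcons u (Letter x)) ** W (Letter x' :: v) =
    (W u ** jA X (val x * val x')) ** W v.
Proof.
move=> ok_u ok_v; rewrite (dia_letters _ (towordK ok_u) (towordK ok_v)).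
rewrite /jA (lin_image (phi := fun g => (W u ** g) ** W v)); last first.
  exact: linear_comp (dial _) (diar _).
apply: lin_ext => y; rewrite /word_of_basis; case: insub => [z|].
  have ok := word_ok_join ok_u ok_v (erefl : _ = is_letter (Letter z)) erefl isT.
  rewrite -cat_rcons in ok *; rewrite -(dia_cat ok).
  by rewrite -cats1 -dia_cat // cats1; apply: word_ok_catl ok.
by rewrite -/(free_one X) dia_g1.
Qed.

(** Inserting a bracket between [u] and [v] is the map [g |-> (W u ** PA g) ** W v], so all three
    terms acquire the same outer factors. *)
Lemma dia_join_brackets u t t' v :
  word_ok (rcons u (Bracket t)) -> word_ok (Bracket t' :: v) ->
  W (rcons u (Bracket t)) ** W (Bracket t' :: v) =
    (W u ** (PA (PA (W t) ** W t') + PA (W t ** PA (W t')) + kappa *: (W t ** W t')))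
      ** W v.
Proof.
move=> ok_u ok_v; rewrite (dia_brackets _ (towordK ok_u) (towordK ok_v)).
have ok_t : word_ok t by have [_] := word_ok_rcons ok_u.
have ok_t' : word_ok t' by have [] := word_ok_cons ok_v.
set lbr := fun y : word _ => _.
have lbrE (g : F) : lin (V := F) lbr g = (W u ** PA g) ** W v.
  rewrite /PA (lin_image (phi := fun g => (W u ** g) ** W v)); last first.
    exact: linear_comp (dial _) (diar _).
  apply: lin_ext => y; have ok := word_ok_join ok_u ok_v
    (erefl : _ = is_letter (Bracket y)) erefl (wseqP y).
  rewrite /lbr -cat_rcons in ok *; rewrite -(dia_cat ok) /bracket.
  by rewrite -cats1 -dia_cat // cats1; apply: word_ok_catl ok.
have Pb w : << bracket w >> = PA << w >> :> F by rewrite /PA lin_base.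
rewrite !(linear_atD (diar _)) (linear_atZ (diar _)).
rewrite !(linear_atD (dial _)) (linear_atZ (dial _)).
rewrite -!Pb.
apply: f_equal2; last by [].
by apply: f_equal2; apply: lbrE.
Qed.

End Words.

(** * Associativity *)

Section Associativity.
Variables (k : comNzRingType) (A : algType k) (X : unital_basis A) (kappa : k).
Local Notation L := (atom (letter X)).
Local Notation sz := (@seq_size k A X).

(* The rules obeyed by dia, for an abstract product on an abstract module in place
   of freeMRB X, so that conversion cannot unfold dia: W s stands for the basis
   element of the word s, and small N for the span of the words of size at most
   N. *)
Record word_product (V : lmodType k) (W : seq L -> V) (J : A -> V) (P : V -> V)
    (mul : V -> V -> V) (small : nat -> V -> Prop) : Prop := WordProduct {
  wp_bilinear : bilinear_map mul;
  wp_J_linear : linear J;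
  wp_P_linear : linear P;
  wp_1l : forall g, mul (W [::]) g = g;
  wp_1r : forall g, mul g (W [::]) = g;
  wp_J1 : J 1 = W [::];
  wp_J : forall x : letter X, J (val x) = W [:: Letter x];
  wp_P : forall s, word_ok s -> P (W s) = W [:: Bracket s];
  wp_cat : forall s1 s2, word_ok (s1 ++ s2) -> mul (W s1) (W s2) = W (s1 ++ s2);
  wp_letters : forall u x x' v,
    word_ok (rcons u (Letter x)) -> word_ok (Letter x' :: v) ->
    mul (W (rcons u (Letter x))) (W (Letter x' :: v)) =
      mul (mul (W u) (J (val x * val x'))) (W v);
  wp_brackets : forall u t t' v,
    word_ok (rcons u (Bracket t)) -> word_ok (Bracket t' :: v) ->
    mul (W (rcons u (Bracket t))) (W (Bracket t' :: v)) =
      mul (mul (W u) (P (mul (P (W t)) (W t')) + P (mul (W t) (P (W t')))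
                      + kappa *: mul (W t) (W t'))) (W v);
  wp_small : forall N, submodule (small N);
  wp_small_leq : forall M N g, (M <= N)%N -> small M g -> small N g;
  wp_small_word : forall s, word_ok s -> small (sz s) (W s);
  wp_small_mul : forall M N g h, small M g -> small N h -> small (M + N)%N (mul g h);
  wp_small_P : forall N g, small N g -> small N.+1 (P g);
  wp_small_span : forall (S : V -> Prop) N g, submodule S ->
    (forall s, word_ok s -> (sz s <= N)%N -> S (W s)) -> small N g -> S g;
  wp_span : forall S : V -> Prop, submodule S ->
    (forall s, word_ok s -> S (W s)) -> forall g, S g
}.

Lemma dia_word_product : word_product (V := freeMRB X) (fun s => << toword s >>)
  (jA X) (@PA k A X) (dia kappa) (@small k A X).
Proof.
apply: WordProduct.
- exact: dia_bilinear.
- exact: jA_linear.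
- exact: PA_linear.
- by move=> g; rewrite toword_nil dia_1g.
- by move=> g; rewrite toword_nil dia_g1.
- by rewrite jA1 toword_nil.
- exact: jA_letter.
- exact: PA_word.
- exact: dia_cat.
- exact: dia_join_letters.
- exact: dia_join_brackets.
- exact: small_submodule.
- exact: small_leq.
- exact: small_word.
- exact: small_dia.
- exact: smallP.
- exact: small_span.
- exact: words_span.
Qed.

Variables (V : lmodType k) (W : seq L -> V) (J : A -> V) (P : V -> V).
Variables (mul : V -> V -> V) (small : nat -> V -> Prop).
Hypothesis wp : word_product W J P mul small.
Local Notation "g ** h" := (mul g h) (at level 40, left associativity).

Let mull h : linear (fun g => g ** h) := (wp_bilinear wp).1 h.
Let mulr g : linear (fun h => g ** h) := (wp_bilinear wp).2 g.
Let Pl := wp_P_linear wp.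

Let mulDl g h l : (g + h) ** l = g ** l + h ** l.
Proof. exact: linear_atD (mull l) g h. Qed.

Let mulDr g h l : g ** (h + l) = g ** h + g ** l.
Proof. exact: linear_atD (mulr g) h l. Qed.

Let mulZl c g h : (c *: g) ** h = c *: (g ** h).
Proof. exact: linear_atZ (mull h) c g. Qed.

Let mulZr c g h : g ** (c *: h) = c *: (g ** h).
Proof. exact: linear_atZ (mulr g) c h. Qed.

(** On words this is the bracket rule with [u] and [v] empty. *)
Lemma wp_mulP g h :
  P g ** P h = P (P g ** h) + P (g ** P h) + kappa *: (g ** h).
Proof.
move: g; apply: (wp_span wp) => [|s ok_s].
  apply: equalizer_submodule; first exact: linear_comp (mull _) Pl.
  apply: linear_add; last exact: linear_scale (mull _).
  apply: linear_add; last exact: linear_comp Pl (mull _).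
  exact: linear_comp Pl (linear_comp (mull _) Pl).
move: h; apply: (wp_span wp) => [|t ok_t].
  apply: equalizer_submodule; first exact: linear_comp (mulr _) Pl.
  apply: linear_add; last exact: linear_scale (mulr _).
  apply: linear_add; first exact: linear_comp Pl (mulr _).
  exact: linear_comp Pl (linear_comp (mulr _) Pl).
rewrite (wp_P wp ok_s) (wp_P wp ok_t).
rewrite (@wp_brackets _ _ _ _ _ _ wp [::] s t [::]) ?word_ok1 //.
by rewrite (wp_1l wp) (wp_1r wp) (wp_P wp ok_s) (wp_P wp ok_t).
Qed.

(** Atoms of different kinds give only concatenations. For equal kinds the recursion rule is
    compared with its own case of empty [u] and [v]. *)
Lemma wp_join u a b v :
  word_ok (rcons u a) -> word_ok (b :: v) ->
  W (rcons u a) ** W (b :: v) = (W u ** (W [:: a] ** W [:: b])) ** W v.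
Proof.
move=> ok_u ok_v; have [_ ok_a] := word_ok_rcons ok_u.
have [ok_b _] := word_ok_cons ok_v.
have [ab|ab] := boolP (is_letter a != is_letter b).
  have ok := word_ok_cat ok_u ok_v ab.
  have ok3 : word_ok ((u ++ [:: a; b]) ++ v) by rewrite -catA -cat_rcons.
  have ok2 := word_ok_catl ok3.
  rewrite (wp_cat wp ok) (wp_cat wp (s1 := [:: a]) (s2 := [:: b])) /=; last first.
    exact: word_ok_catr ok2.
  by rewrite (wp_cat wp ok2) (wp_cat wp ok3) -catA cat_rcons.
case: a b ab ok_a ok_b ok_u ok_v => [x|t] [x'|t'] ab ok_a ok_b ok_u ok_v.
- rewrite (wp_letters wp ok_u ok_v).
  rewrite (@wp_letters _ _ _ _ _ _ wp [::] x x' [::]) //.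
  by rewrite (wp_1l wp) (wp_1r wp).
- by rewrite /= in ab.
- by rewrite /= in ab.
- by rewrite (wp_brackets wp ok_u ok_v) -(wp_P wp ok_a) -(wp_P wp ok_b) wp_mulP.
Qed.

(** Phrased for elements of bounded size rather than for words, since the inductive steps apply it
    to products. *)
Definition assoc_below n := forall M N Q g h l,
  small M g -> small N h -> small Q l -> (M + N + Q < n)%N ->
  (g ** h) ** l = g ** (h ** l).

Lemma assoc_below_words n :
  (forall s1 s2 s3, word_ok s1 -> word_ok s2 -> word_ok s3 ->
     (sz s1 + sz s2 + sz s3 < n)%N ->
     (W s1 ** W s2) ** W s3 = W s1 ** (W s2 ** W s3)) -> assoc_below n.
Proof.
move=> An M N Q g h l sg sh sl lt_n.
apply: (wp_small_span wp (S := fun g => (g ** h) ** l = g ** (h ** l)) _ _ sg).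
  apply: equalizer_submodule; last exact: mull.
  exact: linear_comp (mull _) (mull _).
move=> s1 ok1 le1.
apply: (wp_small_span wp (S := fun h => (W s1 ** h) ** l = W s1 ** (h ** l)) _ _ sh).
  apply: equalizer_submodule; first exact: linear_comp (mull _) (mulr _).
  exact: linear_comp (mulr _) (mull _).
move=> s2 ok2 le2.
apply: (wp_small_span wp (S := fun l => (W s1 ** W s2) ** l = W s1 ** (W s2 ** l))
  _ _ sl).
  apply: equalizer_submodule; first exact: mulr.
  exact: linear_comp (mulr _) (mulr _).
by move=> s3 ok3 le3; apply: An => //; lia.
Qed.

(** After expansion every remaining triple product has at most two factors under [P], hence size at
    most [M + N + Q + 2], within reach of [assoc_below n]. *)
Lemma mulP_assoc n M N Q x y z : assoc_below n ->
  small M x -> small N y -> small Q z -> (M + N + Q + 2 < n)%N ->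
  (P x ** P y) ** P z = P x ** (P y ** P z).
Proof.
move=> An sx sy sw lt_n.
have sPx := wp_small_P wp sx; have sPy := wp_small_P wp sy.
have sPz := wp_small_P wp sw.
set g := P x ** y + x ** P y; set g' := P y ** z + y ** P z.
have Exy : P x ** P y = P g + kappa *: (x ** y).
  by rewrite wp_mulP /g (linear_atD Pl).
have Eyz : P y ** P z = P g' + kappa *: (y ** z).
  by rewrite wp_mulP /g' (linear_atD Pl).
(* Used after the outer expansion: products such as [P g ** z] become triple products of [x], [y],
   [z] and their images under [P], up to terms with [kappa]. *)
have EPg : P g = P x ** P y - kappa *: (x ** y) by rewrite Exy addrK.
have EPg' : P g' = P y ** P z - kappa *: (y ** z) by rewrite Eyz addrK.
rewrite Exy Eyz mulDl mulDr.
rewrite mulZl mulZr !wp_mulP.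
rewrite EPg EPg' /g /g'.
rewrite !mulDl !mulDr -!scaleNr.
rewrite !mulZl !mulZr !(linear_atD Pl) !(linear_atZ Pl).
have A1 : (P x ** P y) ** z = P x ** (P y ** z) by apply: An sPx sPy sw _; lia.
have A2 : (x ** y) ** z = x ** (y ** z) by apply: An sx sy sw _; lia.
have A3 : (P x ** y) ** P z = P x ** (y ** P z) by apply: An sPx sy sPz _; lia.
have A4 : (x ** P y) ** P z = x ** (P y ** P z) by apply: An sx sPy sPz _; lia.
have A5 : (P x ** y) ** z = P x ** (y ** z) by apply: An sPx sy sw _; lia.
have A6 : (x ** P y) ** z = x ** (P y ** z) by apply: An sx sPy sw _; lia.
have A7 : (x ** y) ** P z = x ** (y ** P z) by apply: An sx sy sPz _; lia.
rewrite A1 A2 A3 A4 A5 A6 A7 !scalerDr.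
rewrite (addrACA (P _)) [- _ *: _ + _]addrC -!addrA; do 4 congr (_ + _).
by rewrite addrC -addrA.
Qed.

Lemma wp_JM a b : J a ** J b = J (a * b).
Proof.
have Jl := wp_J_linear wp.
have lb (c : A) : linear (fun a => a * c) by move=> e u v; rewrite mulrDl scalerAl.
have lr (c : A) : linear (fun a => c * a) by move=> e u v; rewrite mulrDr scalerAr.
move: a; apply: (basis_span (X := X)) => [||x].
- apply: equalizer_submodule; first exact: linear_comp (mull _) Jl.
  exact: linear_comp Jl (lb b).
- by rewrite (wp_J1 wp) (wp_1l wp) mul1r.
move: b; apply: (basis_span (X := X)) => [||y].
- apply: equalizer_submodule; first exact: linear_comp (mulr _) Jl.
  exact: linear_comp Jl (lr _).
- by rewrite (wp_J1 wp) (wp_1r wp) mulr1.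
rewrite !(wp_J wp) (@wp_letters _ _ _ _ _ _ wp [::] x y [::]) //.
by rewrite (wp_1l wp) (wp_1r wp).
Qed.

(* m is a combination of 1 and of letters (tau = true) or brackets (tau = false). *)
Definition pure (tau : bool) (m : V) : Prop := forall S : V -> Prop,
  submodule S -> S (W [::]) ->
  (forall d, atom_ok d -> is_letter d = tau -> S (W [:: d])) -> S m.

Lemma pure_J p : pure true (J p).
Proof.
move=> S mS S1 Sd; move: p.
apply: (basis_span (X := X) (S := fun p => S (J p))) => [||x].
- split; first by rewrite (linear_at0 (wp_J_linear wp)); apply: mS.1.
  by move=> a u v Su Sv; rewrite (wp_J_linear wp); apply: mS.2.
- by rewrite (wp_J1 wp).
- by rewrite (wp_J wp); apply: Sd.
Qed.

Lemma pure_P g : pure false (P g).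
Proof.
move=> S mS S1 Sd; move: g; apply: (wp_span wp (S := fun g => S (P g))) => [|s ok_s].
  split; first by rewrite (linear_at0 Pl); apply: mS.1.
  by move=> a u v Su Sv; rewrite Pl; apply: mS.2.
by rewrite (wp_P wp ok_s); apply: Sd.
Qed.

(** All four products are concatenations of segments of one admissible word. *)
Lemma wp_flank s d v : word_ok (s ++ d :: v) ->
  (W s ** W [:: d]) ** W v = W s ** (W [:: d] ** W v).
Proof.
move=> ok; have ok1 : word_ok ((s ++ [:: d]) ++ v) by rewrite -catA.
rewrite (wp_cat wp (word_ok_catl ok1)) (wp_cat wp ok1).
rewrite (wp_cat wp (s1 := [:: d])) /=; last exact: word_ok_catr ok.
by rewrite (wp_cat wp ok) -catA.
Qed.

(** Any atom [d] of the kind of [c] may stand between [a] and [v], so [wp_flank] applies; the unit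
    term is trivial. *)
Lemma pure_flank u a c v m : word_ok (rcons u a) -> word_ok (c :: v) ->
  is_letter a != is_letter c -> pure (is_letter c) m ->
  (W (rcons u a) ** m) ** W v = W (rcons u a) ** (m ** W v).
Proof.
move=> ok_u ok_v ac pm; apply: (pm (fun m =>
  (W (rcons u a) ** m) ** W v = W (rcons u a) ** (m ** W v))) => [||d ok_d dc].
- apply: equalizer_submodule; first exact: linear_comp (mull _) (mulr _).
  exact: linear_comp (mulr _) (mull _).
- by rewrite (wp_1l wp) (wp_1r wp).
have ok_dv : word_ok (d :: v).
  by apply: (@word_ok_join _ [::] d d c v) => //; rewrite word_ok1.
by apply: wp_flank; apply: word_ok_cat => //; rewrite dc.
Qed.

(** The atom [a] witnesses that its kind may follow [u]. For [m = W [::]] both sides are the word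
    [u c v]; for a single atom [d] this is [wp_join] at the junction of [d] and [c]. *)
Lemma pure_joinl u a c v m : word_ok (rcons u a) -> word_ok (c :: v) ->
  is_letter a = is_letter c -> pure (is_letter c) m ->
  (W u ** m) ** W (c :: v) = (W u ** (m ** W [:: c])) ** W v.
Proof.
move=> ok_u ok_v ac pm; apply: (pm (fun m =>
  (W u ** m) ** W (c :: v) = (W u ** (m ** W [:: c])) ** W v)) => [||d ok_d dc].
- apply: equalizer_submodule; first exact: linear_comp (mull _) (mulr _).
  exact: linear_comp (mull _) (linear_comp (mulr _) (mull _)).
- have [ok_c _] := word_ok_cons ok_v.
  have ok := word_ok_join ok_u ok_v ac erefl ok_c.
  rewrite (wp_1l wp) (wp_1r wp) (wp_flank ok).
  by rewrite (wp_cat wp (s1 := [:: c])).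
have ok := word_ok_join ok_u ok_v (etrans ac (esym dc)) (esym dc) ok_d.
have ok1 : word_ok (rcons u d) by rewrite -cat_rcons in ok; apply: word_ok_catl ok.
by rewrite (wp_cat wp) cats1 //; apply: wp_join.
Qed.

Lemma pure_joinr u a c v m : word_ok (rcons u a) -> word_ok (c :: v) ->
  is_letter a = is_letter c -> pure (is_letter c) m ->
  W (rcons u a) ** (m ** W v) = (W u ** (W [:: a] ** m)) ** W v.
Proof.
move=> ok_u ok_v ac pm; have [_ ok_a] := word_ok_rcons ok_u.
apply: (pm (fun m =>
  W (rcons u a) ** (m ** W v) = (W u ** (W [:: a] ** m)) ** W v)) => [||d ok_d dc].
- apply: equalizer_submodule; first exact: linear_comp (mulr _) (mull _).
  exact: linear_comp (mull _) (linear_comp (mulr _) (mulr _)).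
- have ok := word_ok_join ok_u ok_v erefl (esym ac) ok_a.
  rewrite (wp_1l wp) (wp_1r wp) -cat_rcons in ok *.
  by rewrite (wp_cat wp (s1 := u)) cats1 //.
have ok := word_ok_join ok_u ok_v (etrans ac (esym dc)) (esym dc) ok_d.
have ok1 := word_ok_catr ok.
by rewrite (wp_cat wp (s1 := [:: d])) //; apply: wp_join.
Qed.

(** For letters the product lies in the image of [J] and the remainder is 0. For brackets the
    modified Rota-Baxter identity gives a pure part under [P] and the remainder
    [kappa *: (W t ** W t')], which has lost both outer bracket pairs and is open to induction on
    size. *)
Lemma atom_product b c : atom_ok b -> atom_ok c -> is_letter b = is_letter c ->
  exists q h K, [/\ W [:: b] ** W [:: c] = q + h, pure (is_letter c) q,
    small K h & (K < atom_size b + atom_size c)%N].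
Proof.
have h0 : small 0 0 by case: (wp_small wp 0).
case: b c => [x|t] [y|t'] //= ok_t ok_t' _.
  exists (J (val x * val y)), 0, 0; split=> //; last exact: pure_J.
  by rewrite -!(wp_J wp) wp_JM addr0.
exists (P (P (W t) ** W t' + W t ** P (W t'))), (kappa *: (W t ** W t')).
exists (sz t + sz t')%N; split; first 1 last.
- exact: pure_P.
- have [S0 SP] := wp_small wp (sz t + sz t').
  by rewrite -[_ *: _]addr0; apply: SP S0; apply: wp_small_mul wp _ _ _ _ _ _;
    apply: wp_small_word wp _ _.
- by rewrite -!/(seq_size _); lia.
by rewrite -(wp_P wp ok_t) -(wp_P wp ok_t') wp_mulP (linear_atD Pl).
Qed.

Lemma small_atom a : atom_ok a -> small (atom_size a) (W [:: a]).
Proof.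
rewrite -word_ok1 => /(wp_small_word wp).
by rewrite seq_size_cons addn0.
Qed.

(** Letters use associativity of [A], brackets use [mulP_assoc]. The three outer bracket pairs count
    3 in the size, so [<= n] here yields the strict bound with [+ 2] there. *)
Lemma atom_assoc n a b c : assoc_below n -> atom_ok a -> atom_ok b -> atom_ok c ->
  is_letter a = is_letter b -> is_letter b = is_letter c ->
  (atom_size a + atom_size b + atom_size c <= n)%N ->
  (W [:: a] ** W [:: b]) ** W [:: c] = W [:: a] ** (W [:: b] ** W [:: c]).
Proof.
move=> An; case: a b c => [x|s] [y|t] [z|r] //= ok_s ok_t ok_r _ _.
  by rewrite -!(wp_J wp) !wp_JM mulrA.
rewrite -!/(seq_size _) => le_n.
rewrite -(wp_P wp ok_s) -(wp_P wp ok_t) -(wp_P wp ok_r).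
apply: (mulP_assoc An (wp_small_word wp ok_s) (wp_small_word wp ok_t)
  (wp_small_word wp ok_r)); lia.
Qed.

(** Total size [n] is allowed, while [assoc_below n] stops just before it. Products of adjacent
    atoms of equal kind are split by [atom_product]: the pure part is treated by joining words, the
    remainder by [assoc_below n]. *)
Lemma middle_atom_assoc n u a b c v : assoc_below n ->
  word_ok (rcons u a) -> atom_ok b -> word_ok (c :: v) ->
  (sz (rcons u a) + atom_size b + sz (c :: v) <= n)%N ->
  (W (rcons u a) ** W [:: b]) ** W (c :: v) =
  W (rcons u a) ** (W [:: b] ** W (c :: v)).
Proof.
move=> An ok_ua ok_b ok_cv le_n.
have [[ok_u ok_a] [ok_c ok_v]] := (word_ok_rcons ok_ua, word_ok_cons ok_cv).
have ok_b1 : word_ok [:: b] by rewrite word_ok1.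
have L1 : W (rcons u a) ** W [:: b] = W u ** (W [:: a] ** W [:: b]).
  by rewrite (wp_join ok_ua ok_b1) (wp_1r wp).
have [bc|bc] := boolP (is_letter b != is_letter c).
  have ok_bcv := @word_ok_cat _ [::] b c v ok_b1 ok_cv bc.
  by rewrite L1 (wp_cat wp (s1 := [:: b])) // (wp_join ok_ua ok_bcv).
have {}bc : is_letter b = is_letter c by apply/eqP; rewrite negbK in bc.
have R1 : W [:: b] ** W (c :: v) = (W [:: b] ** W [:: c]) ** W v.
  by rewrite (@wp_join [::] b) // (wp_1l wp).
have [q' [h' [K' [E' pq' sh' ltK']]]] := atom_product ok_b ok_c bc.
have [sua su sv] := And3 (wp_small_word wp ok_ua) (wp_small_word wp ok_u)
  (wp_small_word wp ok_v).
have [sa sc scv] := And3 (small_atom ok_a) (small_atom ok_c)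
  (wp_small_word wp ok_cv).
move: (le_n); rewrite seq_size_cons seq_size_rcons => le_n'.
(* If the kinds differ, [u a b] is a word and only [b] and [c] interact. *)
have [ab|ab] := boolP (is_letter a != is_letter b).
  have ok_uab := @word_ok_cat _ u a b [::] ok_ua ok_b1 ab.
  rewrite (wp_cat wp ok_uab) cats1 (wp_join _ ok_cv); last by rewrite -cats1.
  rewrite R1 E' mulDr !mulDl mulDr.
  congr (_ + _); first by apply: pure_flank ok_ua ok_cv _ pq'; rewrite -bc.
  apply: An sua sh' sv _; rewrite seq_size_rcons; clear -ltK' le_n'; lia.
have {}ab : is_letter a = is_letter b by apply/eqP; rewrite negbK in ab.
have ac := etrans ab bc.
have [q [h [K [E pq sh ltK]]]] := atom_product ok_a ok_b ab.
(* All three atoms now have the same kind; both sides are brought to the product of the three atoms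
   between [W u] and [W v], where [atom_assoc] applies. *)
transitivity ((W u ** ((W [:: a] ** W [:: b]) ** W [:: c])) ** W v).
  rewrite L1 E mulDr !mulDl mulDr.
  rewrite mulDl; congr (_ + _).
    by apply: pure_joinl ok_ua ok_cv ac _; rewrite -bc.
  have Ecv : W (c :: v) = W [:: c] ** W v by rewrite (wp_cat wp (s1 := [:: c])).
  have B1 : (W u ** h) ** W (c :: v) = W u ** (h ** W (c :: v)).
    by apply: An su sh scv _; rewrite seq_size_cons; clear -ltK ltK' le_n'; lia.
  have B2 : (h ** W [:: c]) ** W v = h ** (W [:: c] ** W v).
    by apply: An sh sc sv _; clear -ltK ltK' le_n'; lia.
  rewrite B1 Ecv -B2; apply/esym/(An _ _ _ _ _ _ su (wp_small_mul wp sh sc) sv).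
  clear -ltK ltK' le_n'; lia.
rewrite (atom_assoc An ok_a ok_b ok_c ab bc); last by clear -ltK ltK' le_n'; lia.
rewrite R1 E' mulDr mulDr.
rewrite !mulDl mulDr; congr (_ + _).
  by apply/esym/(pure_joinr ok_ua ok_cv ac).
have Eua : W (rcons u a) = W u ** W [:: a] by rewrite (wp_cat wp) cats1.
have B1 : (W (rcons u a) ** h') ** W v = W (rcons u a) ** (h' ** W v).
  by apply: An sua sh' sv _; rewrite seq_size_rcons; clear -ltK ltK' le_n'; lia.
have B2 : (W u ** W [:: a]) ** h' = W u ** (W [:: a] ** h').
  by apply: An su sa sh' _; clear -ltK ltK' le_n'; lia.
by rewrite -B2 -Eua B1.
Qed.

(** Induction on the number of atoms of the middle word, with the outer factors general because [g]
    absorbs the first atom. *)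
Lemma middle_assoc n s M Q g l : assoc_below n -> word_ok s ->
  small M g -> small Q l -> (M + sz s + Q <= n)%N ->
  (g ** W s) ** l = g ** (W s ** l).
Proof.
move=> An; elim: s M Q g l => [|b s IH] M Q g l ok_bs sg sl.
  by rewrite (wp_1l wp) (wp_1r wp).
rewrite seq_size_cons => le_n; have [ok_b ok_s] := word_ok_cons ok_bs.
(* [middle_atom_assoc] extended linearly in the outer factors; an empty outer word is the unit. *)
have atomA M' Q' g' l' : small M' g' -> small Q' l' ->
    (M' + atom_size b + Q' <= n)%N ->
    (g' ** W [:: b]) ** l' = g' ** (W [:: b] ** l').
  move=> sg' sl' le_n'.
  apply: (wp_small_span wp
    (S := fun g' => (g' ** W [:: b]) ** l' = g' ** (W [:: b] ** l')) _ _ sg').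
    apply: equalizer_submodule; last exact: mull.
    exact: linear_comp (mull _) (mull _).
  move=> s1 ok1 le1.
  apply: (wp_small_span wp
    (S := fun l' => (W s1 ** W [:: b]) ** l' = W s1 ** (W [:: b] ** l')) _ _ sl').
    apply: equalizer_submodule; first exact: mulr.
    exact: linear_comp (mulr _) (mulr _).
  move=> [|c v] ok3 le3; first by rewrite !(wp_1r wp).
  elim/last_ind: s1 ok1 le1 => [|u a _] ok1 le1; first by rewrite !(wp_1l wp).
  by apply: (middle_atom_assoc An) => //; lia.
have sb := small_atom ok_b; have ss := wp_small_word wp ok_s.
have -> : W (b :: s) = W [:: b] ** W s by rewrite (wp_cat wp).
(* The goal is one edge of the associativity pentagon of [g], [W [:: b]], [W s], [l]; the other four
   have [W [:: b]] or [W s] as middle factor. *)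
rewrite -(atomA _ _ _ _ sg ss); last by lia.
rewrite (IH _ _ _ _ ok_s (wp_small_mul wp sg sb) sl); last by lia.
rewrite (atomA _ _ _ _ sg (wp_small_mul wp ss sl)); last by lia.
by rewrite (IH _ _ _ _ ok_s sb sl); last by lia.
Qed.

Lemma assoc_all n : assoc_below n.
Proof.
elim: n => [|n An]; first by move=> M N Q g h l _ _ _; rewrite ltn0.
apply: assoc_below_words => s1 s2 s3 ok1 ok2 ok3 le_n.
exact: (middle_assoc An ok2 (wp_small_word wp ok1) (wp_small_word wp ok3)).
Qed.

Lemma wp_mulA g h l : g ** (h ** l) = (g ** h) ** l.
Proof.
apply/esym; move: g; apply: (wp_span wp) => [|s1 ok1].
  apply: equalizer_submodule; last exact: mull.
  exact: linear_comp (mull _) (mull _).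
move: h; apply: (wp_span wp) => [|s2 ok2].
  apply: equalizer_submodule; first exact: linear_comp (mull _) (mulr _).
  exact: linear_comp (mulr _) (mull _).
move: l; apply: (wp_span wp) => [|s3 ok3].
  apply: equalizer_submodule; first exact: mulr.
  exact: linear_comp (mulr _) (mulr _).
exact: (assoc_all (wp_small_word wp ok1) (wp_small_word wp ok2)
  (wp_small_word wp ok3) (ltnSn _)).
Qed.

End Associativity.

(** * The universal property *)

Definition modified_RB (k : comNzRingType) (kappa : k) (R : lmodType k)
    (mul : R -> R -> R) (P : R -> R) : Prop := forall u v,
  mul (P u) (P v) = P (mul u (P v)) + P (mul (P u) v) + kappa *: mul u v.

Section Evaluation.
Variables (k : comNzRingType) (A : algType k) (X : unital_basis A) (kappa : k).
Variables (R : lmodType k) (mulR : R -> R -> R) (oneR : R) (PR : R -> R) (f : A -> R).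
Local Notation L := (atom (letter X)).
Local Notation sz := (@seq_size k A X).

(** The value that any morphism extending [f] must give to an atom. The fold of [eval_seq] is
    spelled out because the recursion passes through [seq]. *)
Fixpoint eval_atom (a : L) : R :=
  match a with
  | Letter x => f (val x)
  | Bracket s => PR (foldr mulR oneR (map eval_atom s))
  end.

Definition eval_seq (s : seq L) : R := foldr mulR oneR (map eval_atom s).

Variables (V : lmodType k) (W : seq L -> V) (J : A -> V) (P : V -> V).
Variables (mul : V -> V -> V) (small : nat -> V -> Prop).
Hypothesis wp : word_product kappa W J P mul small.
Local Notation "g ** h" := (mul g h) (at level 40, left associativity).

Lemma wp_RB : modified_RB kappa mul P.
Proof. by move=> u v; rewrite (wp_mulP wp) [P (P u ** v) + _]addrC. Qed.

(** A word is the product of its atoms and a bracket is [P] of its content, so induction on the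
    nesting of brackets reaches every word. *)
Lemma wp_generated (S : V -> Prop) : submodule S -> (forall a, S (J a)) ->
  (forall g h, S g -> S h -> S (g ** h)) -> (forall g, S g -> S (P g)) ->
  forall g, S g.
Proof.
move=> mS SJ SM SP; have S1 : S (W [::]) by rewrite -(wp_J1 wp).
have Sseq s : word_ok s -> (forall a, a \in s -> S (W [:: a])) -> S (W s).
  elim: s => // a s IH ok Sa; have [_ ok_s] := word_ok_cons ok.
  have -> : W (a :: s) = W [:: a] ** W s by rewrite (wp_cat wp).
  apply: SM; first by apply: Sa; rewrite mem_head.
  by apply: IH => // b bs; apply: Sa; rewrite in_cons bs orbT.
have Satom a : atom_ok a -> S (W [:: a]).
  elim/atom_ind_seq: a => [x _|s IH ok_s]; first by rewrite -(wp_J wp).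
  rewrite -(wp_P wp ok_s); apply/SP/Sseq => // a as_; apply: IH => //.
  by case/andP: ok_s => _ /allP; apply.
apply: (wp_span wp) => // s ok_s; apply: Sseq => // a as_.
by case/andP: ok_s => _ /allP/(_ a as_)/Satom.
Qed.

Variable ev : V -> R.
Hypotheses (ev_linear : linear ev) (evW : forall s, word_ok s -> ev (W s) = eval_seq s).
Hypotheses (aR : is_algebra mulR oneR) (PR_linear : linear PR)
  (PR_RB : modified_RB kappa mulR PR).
Hypothesis fm : is_alg_morphism *%R 1 mulR oneR f.
Local Notation "x ## y" := (mulR x y) (at level 40, left associativity).

Let mull h : linear (fun g => g ** h) := (wp_bilinear wp).1 h.
Let mulr g : linear (fun h => g ** h) := (wp_bilinear wp).2 g.
Let mulRl h : linear (fun g => g ## h) := (alg_bilinear aR).1 h.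
Let mulRr g : linear (fun h => g ## h) := (alg_bilinear aR).2 g.

Let mulDl g h l : (g + h) ** l = g ** l + h ** l.
Proof. exact: linear_atD (mull l) g h. Qed.

Let mulDr g h l : g ** (h + l) = g ** h + g ** l.
Proof. exact: linear_atD (mulr g) h l. Qed.

Let mulRDl g h l : (g + h) ## l = g ## l + h ## l.
Proof. exact: linear_atD (mulRl l) g h. Qed.

Let mulRDr g h l : g ## (h + l) = g ## h + g ## l.
Proof. exact: linear_atD (mulRr g) h l. Qed.

Lemma eval_seq_cat s t : eval_seq (s ++ t) = eval_seq s ## eval_seq t.
Proof.
elim: s => [|a s IH]; first by rewrite (alg_mul1 aR).
by rewrite /eval_seq /= -!/(eval_seq _) IH (alg_mulA aR).
Qed.

Lemma eval_seq1 a : eval_seq [:: a] = eval_atom a.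
Proof. by rewrite /eval_seq /= (alg_mulr1 aR). Qed.

Lemma ev_cat s t : word_ok (s ++ t) -> ev (W s ** W t) = ev (W s) ## ev (W t).
Proof.
move=> ok; rewrite (wp_cat wp ok) evW //.
rewrite (evW (word_ok_catl ok)) (evW (word_ok_catr ok)).
exact: eval_seq_cat.
Qed.

Lemma ev1 : ev (W [::]) = oneR. Proof. by rewrite evW. Qed.

Lemma ev_J p : ev (J p) = f p.
Proof.
have lf := algm_linear fm.
move: p; apply: (basis_span (X := X)) => [||x].
- apply: equalizer_submodule => //; exact: linear_comp ev_linear (wp_J_linear wp).
- by rewrite (wp_J1 wp) ev1 (algm_one fm).
- by rewrite (wp_J wp) evW // eval_seq1.
Qed.

Lemma ev_P g : ev (P g) = PR (ev g).
Proof.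
move: g; apply: (wp_span wp) => [|s ok_s].
  apply: equalizer_submodule; first exact: linear_comp ev_linear (wp_P_linear wp).
  exact: linear_comp PR_linear ev_linear.
by rewrite (wp_P wp ok_s) !evW ?word_ok1 // eval_seq1.
Qed.

Definition ev_mul_below n := forall M N g h, small M g -> small N h ->
  (M + N < n)%N -> ev (g ** h) = ev g ## ev h.

Lemma ev_mul_below_words n :
  (forall s t, word_ok s -> word_ok t -> (sz s + sz t < n)%N ->
     ev (W s ** W t) = ev (W s) ## ev (W t)) -> ev_mul_below n.
Proof.
move=> En M N g h sg sh lt_n.
apply: (wp_small_span wp (S := fun g => ev (g ** h) = ev g ## ev h) _ _ sg).
  apply: equalizer_submodule; first exact: linear_comp ev_linear (mull _).
  exact: linear_comp (mulRl _) ev_linear.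
move=> s ok_s le_s.
apply: (wp_small_span wp (S := fun h => ev (W s ** h) = ev (W s) ## ev h) _ _ sh).
  apply: equalizer_submodule; first exact: linear_comp ev_linear (mulr _).
  exact: linear_comp (mulRr _) ev_linear.
by move=> t ok_t le_t; apply: En => //; lia.
Qed.

(** The unit term leaves the smaller product [W u ** W v]; an atom gives an admissible word, where
    evaluation is multiplicative by construction. *)
Lemma ev_pure n u a c v m : ev_mul_below n ->
  word_ok (rcons u a) -> word_ok (c :: v) -> is_letter a = is_letter c ->
  (sz u + sz v < n)%N -> pure W (is_letter c) m ->
  ev ((W u ** m) ** W v) = (ev (W u) ## ev m) ## ev (W v).
Proof.
move=> En ok_u ok_v ac lt_n pm.
apply: (pm (fun m => ev ((W u ** m) ** W v) = (ev (W u) ## ev m) ## ev (W v)))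
  => [||d ok_d dc].
- apply: equalizer_submodule.
    exact: linear_comp ev_linear (linear_comp (mull _) (mulr _)).
  exact: linear_comp (mulRl _) (linear_comp (mulRr _) ev_linear).
- rewrite (wp_1r wp) ev1 (alg_mulr1 aR).
  have [[ok_u' _] [_ ok_v']] := (word_ok_rcons ok_u, word_ok_cons ok_v).
  exact: En (wp_small_word wp ok_u') (wp_small_word wp ok_v') lt_n.
have ok := word_ok_join ok_u ok_v (etrans ac (esym dc)) (esym dc) ok_d.
have ok1 : word_ok ((u ++ [:: d]) ++ v) by rewrite -catA.
have ok2 := word_ok_catl ok1.
by rewrite -(ev_cat ok2) (wp_cat wp ok2) (ev_cat ok1).
Qed.

(** For letters [f] is multiplicative. For brackets [P] and [PR] satisfy the same identity, whose
    right-hand side involves three smaller products. *)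
Lemma ev_atoms n a b : ev_mul_below n -> atom_ok a -> atom_ok b ->
  is_letter a = is_letter b -> (atom_size a + atom_size b <= n)%N ->
  ev (W [:: a] ** W [:: b]) = ev (W [:: a]) ## ev (W [:: b]).
Proof.
move=> En; case: a b => [x|s] [y|t] //= ok_s ok_t _.
  by rewrite -!(wp_J wp) (wp_JM wp) !ev_J (algm_mul fm).
rewrite -!/(seq_size _) -(wp_P wp ok_s) -(wp_P wp ok_t) => le_n.
have ss := wp_small_word wp ok_s; have st := wp_small_word wp ok_t.
have E1 : ev (P (W s) ** W t) = ev (P (W s)) ## ev (W t).
  by apply: En (wp_small_P wp ss) st _; lia.
have E2 : ev (W s ** P (W t)) = ev (W s) ## ev (P (W t)).
  by apply: En ss (wp_small_P wp st) _; lia.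
have E3 : ev (W s ** W t) = ev (W s) ## ev (W t) by apply: En ss st _; lia.
rewrite (wp_mulP wp) !(linear_atD ev_linear) (linear_atZ ev_linear) !ev_P E1 E2 E3.
by rewrite !ev_P PR_RB; congr (_ + _); rewrite addrC.
Qed.

(** As for associativity, words are joined at their adjacent atoms, whose product splits into a pure
    part and a smaller remainder. *)
Lemma ev_mul_all n : ev_mul_below n.
Proof.
elim: n => [|n En]; first by move=> M N g h _ _; rewrite ltn0.
apply: ev_mul_below_words => s t; elim/last_ind: s => [|u a _].
  by move=> _ ok_t _; rewrite (wp_1l wp) ev1 (alg_mul1 aR).
case: t => [|b v] ok_ua ok_bv le_n; first by rewrite (wp_1r wp) ev1 (alg_mulr1 aR).
have [[ok_u ok_a] [ok_b ok_v]] := (word_ok_rcons ok_ua, word_ok_cons ok_bv).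
have [ab|ab] := boolP (is_letter a != is_letter b).
  by apply: ev_cat; apply: word_ok_cat.
have {}ab : is_letter a = is_letter b by apply/eqP; rewrite negbK in ab.
have [q [h [K [E pq sh ltK]]]] := atom_product wp ok_a ok_b ab.
have [su sv] := (wp_small_word wp ok_u, wp_small_word wp ok_v).
move: le_n; rewrite seq_size_cons seq_size_rcons => le_n.
have gt_a := atom_size_gt0 a; have gt_b := atom_size_gt0 b.
have Eab : ev (W [:: a] ** W [:: b]) = ev (W [:: a]) ## ev (W [:: b]).
  by apply: (ev_atoms En) => //; clear -le_n; lia.
have Eu : ev (W (rcons u a)) = ev (W u) ## ev (W [:: a]).
  have ok : word_ok (u ++ [:: a]) by rewrite cats1.
  by rewrite -(ev_cat ok) (wp_cat wp ok) cats1.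
have Ev : ev (W (b :: v)) = ev (W [:: b]) ## ev (W v).
  by rewrite -(@ev_cat [:: b]) // (wp_cat wp).
rewrite (wp_join wp ok_ua ok_bv) Eu Ev -!(alg_mulA aR).
rewrite (alg_mulA aR (ev (W [:: a]))) -Eab E mulDr mulDl !(linear_atD ev_linear).
rewrite mulRDl mulRDr; congr (_ + _).
  rewrite (ev_pure En ok_ua ok_bv ab _ pq) ?(alg_mulA aR) //.
  by clear -le_n gt_a gt_b; lia.
have E1 : ev ((W u ** h) ** W v) = ev (W u ** h) ## ev (W v).
  by apply: En (wp_small_mul wp su sh) sv _; clear -le_n ltK; lia.
have E2 : ev (W u ** h) = ev (W u) ## ev h.
  by apply: En su sh _; clear -le_n ltK; lia.
by rewrite E1 E2 (alg_mulA aR).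
Qed.

Lemma ev_mul g h : ev (g ** h) = ev g ## ev h.
Proof.
move: g; apply: (wp_span wp) => [|s ok_s].
  apply: equalizer_submodule; first exact: linear_comp ev_linear (mull _).
  exact: linear_comp (mulRl _) ev_linear.
move: h; apply: (wp_span wp) => [|t ok_t].
  apply: equalizer_submodule; first exact: linear_comp ev_linear (mulr _).
  exact: linear_comp (mulRr _) ev_linear.
exact: (ev_mul_all (wp_small_word wp ok_s) (wp_small_word wp ok_t) (ltnSn _)).
Qed.

End Evaluation.

(** * The free modified Rota-Baxter algebra on [A] *)

Section FreeModifiedRB.
Variables (k : comNzRingType) (A : algType k) (X : unital_basis A) (kappa : k).
Local Notation F := (freeMRB X).

Lemma dia_algebra : is_algebra (@dia k A X kappa) (free_one X).
Proof.
have wp := dia_word_product X kappa; split.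
- exact: dia_bilinear.
- by move=> g h l; exact: (wp_mulA wp).
- exact: dia_1g.
- exact: dia_g1.
Qed.

Lemma jA_alg_morphism :
  is_alg_morphism *%R 1 (@dia k A X kappa) (free_one X) (jA X).
Proof.
split; [exact: jA_linear | exact: jA1 |].
by move=> a b; rewrite (wp_JM (dia_word_product X kappa)).
Qed.

Lemma freeMRB_generated (S : F -> Prop) : submodule S -> (forall a, S (jA X a)) ->
  (forall g h, S g -> S h -> S (dia kappa g h)) -> (forall g, S g -> S (PA g)) ->
  forall g, S g.
Proof. exact: (wp_generated (dia_word_product X kappa)). Qed.

Variables (R : lmodType k) (mulR : R -> R -> R) (oneR : R) (PR : R -> R) (f : A -> R).

Lemma freeMRB_lift : is_algebra mulR oneR -> linear PR ->
  modified_RB kappa mulR PR -> is_alg_morphism *%R 1 mulR oneR f ->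
  exists g : F -> R,
    is_mRB_morphism (dia kappa) (free_one X) (@PA k A X) mulR oneR PR g
    /\ forall a, g (jA X a) = f a.
Proof.
move=> aR lP rb fm; have wp := dia_word_product X kappa.
pose g : F -> R := lin (fun w : bword X => eval_seq mulR oneR PR f w).
have lg : linear g by exact: linearP.
have gW (s : seq (atom (letter X))) : word_ok s ->
    g << toword s >> = eval_seq mulR oneR PR f s.
  by move=> ok_s; rewrite /g lin_base towordK.
exists g; split; last exact: (ev_J wp lg gW aR fm).
split; last exact: (ev_P wp lg gW aR lP).
split=> //; last exact: (ev_mul wp lg gW aR lP rb fm).
by rewrite -toword_nil gW.
Qed.

(** The equalizer of two morphisms is closed under the product and [PA], so agreement on the
    generators suffices. *)
Lemma freeMRB_lift_unique (g h : F -> R) :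
  is_mRB_morphism (dia kappa) (free_one X) (@PA k A X) mulR oneR PR g ->
  is_mRB_morphism (dia kappa) (free_one X) (@PA k A X) mulR oneR PR h ->
  (forall a, g (jA X a) = h (jA X a)) -> g =1 h.
Proof.
move=> [[lg g1 gM] gP] [[lh h1 hM] hP] gh; apply: freeMRB_generated => //.
- exact: equalizer_submodule.
- by move=> x y ex ey; rewrite gM hM ex ey.
- by move=> x ex; rewrite gP hP ex.
Qed.

End FreeModifiedRB.

(** * The bialgebra structure *)

Section CoproductOperator.
Variables (k : comNzRingType) (lambda : k) (B : lmodType k).
Variables (mul : B -> B -> B) (one : B) (P : B -> B) (eps : B -> k^o).
Hypotheses (aB : is_algebra mul one) (P_linear : linear P)
  (P_RB : modified_RB (- lambda ^+ 2) mul P).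
Hypothesis eps_morphism : is_alg_morphism mul one ( *%R : k^o -> k^o -> k^o) 1 eps.
Hypothesis eps_P : forall u, eps (P u) = (- lambda) *: eps u.
Local Notation "g ** h" := (mul g h) (at level 40, left associativity).
Local Notation e := (eps : B -> k).

Definition shiftP (u : B) : B := P u + lambda *: u.

Let mull h : linear (fun g => g ** h) := (alg_bilinear aB).1 h.
Let mulr g : linear (fun h => g ** h) := (alg_bilinear aB).2 g.
Let el : linear eps := algm_linear eps_morphism.

Let mulDl g h l : (g + h) ** l = g ** l + h ** l.
Proof. exact: linear_atD (mull l) g h. Qed.
Let mulDr g h l : g ** (h + l) = g ** h + g ** l.
Proof. exact: linear_atD (mulr g) h l. Qed.
Let mulZl c g h : (c *: g) ** h = c *: (g ** h).
Proof. exact: linear_atZ (mull h) c g. Qed.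
Let mulZr c g h : g ** (c *: h) = c *: (g ** h).
Proof. exact: linear_atZ (mulr g) c h. Qed.
Let PD : {morph P : u v / u + v} := linear_atD P_linear.
Let PZ : forall c u, P (c *: u) = c *: P u := linear_atZ P_linear.

Lemma shiftP_linear : linear shiftP.
Proof. by apply: linear_add => //; apply: linear_scale; apply: linear_id. Qed.

Lemma eps_shiftP u : eps (shiftP u) = 0.
Proof.
rewrite /shiftP (linear_atD el) (linear_atZ el) eps_P.
by rewrite scaleNr addNr.
Qed.

(* shiftP is a Rota-Baxter operator of weight - 2 lambda. *)
Lemma shiftP_RB u v : shiftP u ** shiftP v =
  shiftP (u ** shiftP v) + shiftP (shiftP u ** v)
  + (- lambda) *: shiftP (u ** v) + (- lambda) *: shiftP (u ** v).
Proof.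
rewrite /shiftP !(mulDl, mulDr, mulZl, mulZr, PD, PZ, scalerDr) P_RB !scalerA.
rewrite !mulNr !scaleNr -expr2.
move: (P (u ** P v)) (P (P u ** v)) (lambda *: (P u ** v)) (lambda *: (u ** P v))
  (lambda *: P (u ** v)) (lambda ^+ 2 *: (u ** v)) => x1 x2 x3 x4 x5 x6.
(* Eight of the twelve terms on the right and two of the six on the left cancel in pairs. *)
rewrite [RHS](AC (((2*2)*(2*2))*2*2) (1*5*7*3*(2*9)*(6*11)*(4*10)*(8*12))) /=.
by rewrite [LHS](AC (4*2) (1*2*4*5*(6*3))) /= !subrr !addr0.
Qed.

(* T, te, tm and Q stand for tensor B B, tens, tmul mul mul and the operator QM;
   below, T3 and te3 stand for B (x) (B (x) B) and its pure tensors, and L s v for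
   s (x) v in it. *)
Section PureTensors.
Variables (T : lmodType k) (te : B -> B -> T) (tm : T -> T -> T) (Q : T -> T).
Hypotheses (te_bilinear : bilinear_map te) (tm_bilinear : bilinear_map tm).
Hypothesis tm_te : forall u v u' v', tm (te u v) (te u' v') = te (u ** u') (v ** v').
Hypothesis Q_linear : linear Q.
Hypothesis Q_te : forall u v, Q (te u v) = te (shiftP u) (e v *: one) + te u (P v).

Let teDl u u' v : te (u + u') v = te u v + te u' v.
Proof. exact: linear_atD (te_bilinear.1 v) u u'. Qed.
Let teDr u v v' : te u (v + v') = te u v + te u v'.
Proof. exact: linear_atD (te_bilinear.2 u) v v'. Qed.
Let teZl c u v : te (c *: u) v = c *: te u v.
Proof. exact: linear_atZ (te_bilinear.1 v) c u. Qed.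
Let teZr c u v : te u (c *: v) = c *: te u v.
Proof. exact: linear_atZ (te_bilinear.2 u) c v. Qed.
Let tmDl u u' v : tm (u + u') v = tm u v + tm u' v.
Proof. exact: linear_atD (tm_bilinear.1 v) u u'. Qed.
Let tmDr u v v' : tm u (v + v') = tm u v + tm u v'.
Proof. exact: linear_atD (tm_bilinear.2 u) v v'. Qed.

(** Since [eps (v ** P v')] and [eps (P v ** v')] are both [- lambda] times [eps v * eps v'], the
    right-hand side contains [shiftP (u ** u')] twice with factor [- lambda], as [shiftP_RB]
    demands. The terms with first component [u ** u'] match by the identity for [P]. *)
Lemma Q_RB_pure u v u' v' :
  tm (Q (te u v)) (Q (te u' v')) =
    Q (tm (te u v) (Q (te u' v'))) + Q (tm (Q (te u v)) (te u' v'))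
    + (- lambda ^+ 2) *: tm (te u v) (te u' v').
Proof.
rewrite !Q_te !tmDl !tmDr !tm_te !(linear_atD Q_linear) !Q_te.
rewrite !(mulZl, mulZr, alg_mul1 aB, alg_mulr1 aB) P_RB.
rewrite !(algm_mul eps_morphism) !(linear_atZ el) !eps_P !PZ.
have scE (a : k) (b : k^o) : a *: b = a * b by [].
rewrite !scE shiftP_RB; move: shiftP => S.
rewrite !(teDl, teDr, teZl, teZr, scalerDr, scalerA).
rewrite [eps v' * eps v]mulrC [eps v * (- lambda * _)]mulrCA !mulrA.
(* Both sides are sums of nine multiples of pure tensors; the permutation matches them. *)
rewrite [RHS](AC (((2*2)*(2*2))*1) (((((1*5)*3)*7)*6)*(2*((4*8)*9)))) /=.
by rewrite [eps v * - lambda]mulrC.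
Qed.

Section TripleTensors.
Variables (Delta : B -> T) (T3 : lmodType k) (te3 : B -> T -> T3).
Variables (L : T -> B -> T3) (epsT : T -> k^o) (Q3 : T3 -> T3).
Hypotheses (te3_bilinear : bilinear_map te3) (L_bilinear : bilinear_map L).
Hypothesis te_span : forall S : T -> Prop,
  submodule S -> (forall u v, S (te u v)) -> forall t, S t.
Hypothesis Q3_linear : linear Q3.
Hypothesis L_te : forall p q v, L (te p q) v = te3 p (te q v).
Hypothesis Q3_te : forall u s,
  Q3 (te3 u s) = te3 (shiftP u) ((epsT s : k) *: te one one) + te3 u (Q s).
Hypothesis epsT_te : forall p q, epsT (te p q) = e p * e q.
Hypotheses (Delta_linear : linear Delta) (Delta1 : Delta one = te one one).
Hypothesis Delta_P : forall u, Delta (P u) = Q (Delta u).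
Hypothesis epsT_Delta : forall u, epsT (Delta u) = eps u.

Let te3Dr u s t : te3 u (s + t) = te3 u s + te3 u t.
Proof. exact: linear_atD (te3_bilinear.2 u) s t. Qed.
Let te3Zr c u s : te3 u (c *: s) = c *: te3 u s.
Proof. exact: linear_atZ (te3_bilinear.2 u) c s. Qed.
Let LDl s t v : L (s + t) v = L s v + L t v.
Proof. exact: linear_atD (L_bilinear.1 v) s t. Qed.
Let LZl c s v : L (c *: s) v = c *: L s v.
Proof. exact: linear_atZ (L_bilinear.1 v) c s. Qed.

Lemma Q3_right u v : te3 (shiftP u) (Delta (e v *: one)) + te3 u (Delta (P v)) =
  Q3 (te3 u (Delta v)).
Proof. by rewrite Q3_te epsT_Delta Delta_P (linear_atZ Delta_linear) Delta1. Qed.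

(** [Delta u] may be replaced by a pure tensor [te p q]. The summand [lambda *: u] of [shiftP u]
    turns [P q] into [shiftP q], so the terms with first component [p] combine to [Q (te q v)]; the
    remaining one carries [e q * e v], that is [epsT (te q v)]. *)
Lemma Q3_left u v :
  L (Delta (shiftP u)) (e v *: one) + L (Delta u) (P v) = Q3 (L (Delta u) v).
Proof.
rewrite {1}/shiftP (linear_atD Delta_linear) (linear_atZ Delta_linear) Delta_P.
move: (Delta u) => s; move: s; apply: te_span => [|p q].
  apply: equalizer_submodule; last exact: linear_comp Q3_linear (L_bilinear.1 v).
  apply: linear_add (L_bilinear.1 (P v)).
  have lS : linear (fun s => Q s + lambda *: s).
    exact: linear_add Q_linear (linear_scale lambda (@linear_id k T)).
  exact: linear_comp (L_bilinear.1 _) lS.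
rewrite Q_te !LDl LZl !L_te Q3_te epsT_te Q_te /shiftP !te3Dr !teDl !teZl !teZr.
by rewrite !te3Dr !te3Zr !scalerA -!addrA; congr (_ + _).
Qed.

End TripleTensors.
End PureTensors.

(** The operator [QM] over an abstract algebra [B]; for [freeMRB X] the two are convertible. *)
Definition coproduct_op : tensor B B -> tensor B B :=
  tlift (fun u v => tens (shiftP u) (e v *: one) + tens u (P v)).

Lemma coproduct_op_bilinear :
  bilinear_map (fun u v => tens (shiftP u) (e v *: one) + tens u (P v)).
Proof.
apply: bilinear_add; last exact: bilinear_tens (@linear_id k B) P_linear.
exact: bilinear_tens shiftP_linear (linear_scale_vec one el).
Qed.

Lemma coproduct_op_linear : linear coproduct_op.
Proof. exact: tlift_is_linear coproduct_op_bilinear. Qed.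

Lemma coproduct_op_tens u v :
  coproduct_op (tens u v) = tens (shiftP u) (e v *: one) + tens u (P v).
Proof. exact: tlift_tens coproduct_op_bilinear u v. Qed.

Lemma coproduct_op_RB :
  modified_RB (- lambda ^+ 2) (tmul mul mul) coproduct_op.
Proof.
have lQ := coproduct_op_linear.
have bm := tmul_bilinear (alg_bilinear aB) (alg_bilinear aB).
move=> s t; move: s; apply: tens_span => [|u v].
  apply: equalizer_submodule; first exact: linear_comp (bm.1 _) lQ.
  apply: linear_add; last exact: linear_scale (bm.1 _).
  apply: linear_add; first exact: linear_comp lQ (bm.1 _).
  exact: linear_comp lQ (linear_comp (bm.1 _) lQ).
move: t; apply: tens_span => [|u' v'].
  apply: equalizer_submodule; first exact: linear_comp (bm.2 _) lQ.
  apply: linear_add; last exact: linear_scale (bm.2 _).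
  apply: linear_add; last exact: linear_comp lQ (bm.2 _).
  exact: linear_comp lQ (linear_comp (bm.2 _) lQ).
exact: (Q_RB_pure (tens_bilinear B B) bm
  (tmul_tens (alg_bilinear aB) (alg_bilinear aB)) lQ coproduct_op_tens).
Qed.

(** * Counit laws and coassociativity, checked on generators *)

Section Coalgebra.
Variables (A : lmodType k) (DeltaA : A -> tensor A A) (epsA : A -> k^o).
Variables (j : A -> B) (Delta : B -> tensor B B).
Hypotheses (coA : is_coalgebra DeltaA epsA) (j_linear : linear j).
Hypothesis Delta_morphism :
  is_alg_morphism mul one (tmul mul mul) (tens one one) Delta.
Hypotheses (Delta_P : forall u, Delta (P u) = coproduct_op (Delta u))
  (Delta_j : forall a, Delta (j a) = tmap j j (DeltaA a))
  (eps_j : forall a, eps (j a) = epsA a).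
Hypothesis generated : forall S : B -> Prop, submodule S -> (forall a, S (j a)) ->
  (forall g h, S g -> S h -> S (g ** h)) -> (forall g, S g -> S (P g)) ->
  forall g, S g.

Let Dl : linear Delta := algm_linear Delta_morphism.
Let bm := tmul_bilinear (alg_bilinear aB) (alg_bilinear aB).
Let lQ := coproduct_op_linear.

(** Shared by both counit laws, with [c] the contraction of one tensor factor. The composite of [c]
    with [Delta] is multiplicative, commutes with [P] and fixes the image of [j], so it is the
    identity. *)
Lemma counit_generated (c : tensor B B -> B) (cA : tensor A A -> A) :
  linear c -> linear cA ->
  (forall y z, c (tens (j y) (j z)) = j (cA (tens y z))) ->
  (forall y z y' z',
     c (tens (y ** y') (z ** z')) = c (tens y z) ** c (tens y' z')) ->
  (forall y z, c (coproduct_op (tens y z)) = P (c (tens y z))) ->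
  (forall a, cA (DeltaA a) = a) -> forall u, c (Delta u) = u.
Proof.
move=> lc lcA cj cM cP cAK.
have cjE t : c (tmap j j t) = j (cA t).
  move: t; apply: tens_ext => [||y z]; last by rewrite (tmap_tens j_linear j_linear).
    exact: linear_comp lc (tmap_linear j_linear j_linear).
  exact: linear_comp j_linear lcA.
have cME s t : c (tmul mul mul s t) = c s ** c t.
  move: s; apply: tens_ext => [||y z].
  - exact: linear_comp lc (bm.1 _).
  - exact: linear_comp (mull _) lc.
  move: t; apply: tens_ext => [||y' z'].
  - exact: linear_comp lc (bm.2 _).
  - exact: linear_comp (mulr _) lc.
  by rewrite (tmul_tens (alg_bilinear aB) (alg_bilinear aB)) cM.
have cPE t : c (coproduct_op t) = P (c t).
  by move: t; apply: tens_ext => //; [exact: linear_comp lc lQ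
    | exact: linear_comp P_linear lc].
apply: generated => [|a|g h eg eh|g eg].
- by apply: equalizer_submodule; [exact: linear_comp lc Dl | exact: linear_id].
- by rewrite Delta_j cjE cAK.
- by rewrite (algm_mul Delta_morphism) cME eg eh.
- by rewrite Delta_P cPE eg.
Qed.

Let counitl_bilin (C : lmodType k) (f : C -> k^o) : linear f ->
  bilinear_map (fun y z : C => (f y : k) *: z).
Proof.
move=> lf; split=> [z|y]; first exact: linear_scale_vec.
by apply: linear_scale; apply: linear_id.
Qed.

Let counitr_bilin (C : lmodType k) (f : C -> k^o) : linear f ->
  bilinear_map (fun y z : C => (f z : k) *: y).
Proof.
move=> lf; split=> [z|y]; first by apply: linear_scale; apply: linear_id.
exact: linear_scale_vec.
Qed.

(** [eps] kills [shiftP], so contracting the first factor of [coproduct_op] leaves only the term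
    with [P z]. *)
Lemma counitl u : tlift (fun y z => e y *: z) (Delta u) = u.
Proof.
have b := counitl_bilin el; have bA := counitl_bilin (coalg_eps_linear coA).
have c_tens (y z : B) : tlift (fun y z => e y *: z) (tens y z) = e y *: z.
  exact: tlift_tens b y z.
move: u; apply: (counit_generated (tlift_is_linear b) (tlift_is_linear bA))
  => [y z|y z y' z'|y z|a].
- by rewrite c_tens (tlift_tens bA) eps_j (linear_atZ j_linear).
- by rewrite !c_tens (algm_mul eps_morphism) mulZl mulZr scalerA.
- rewrite coproduct_op_tens (linear_atD (tlift_is_linear b)) !c_tens eps_shiftP.
  by rewrite scale0r add0r PZ.
- exact: coalg_counitl coA a.
Qed.

(** The factor [- lambda] from [eps (P z)] cancels the summand [lambda *: y] of [shiftP y], leaving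
    [P y] scaled by [e z]. *)
Lemma counitr u : tlift (fun y z => e z *: y) (Delta u) = u.
Proof.
have b := counitr_bilin el; have bA := counitr_bilin (coalg_eps_linear coA).
have c_tens (y z : B) : tlift (fun y z => e z *: y) (tens y z) = e z *: y.
  exact: tlift_tens b y z.
move: u; apply: (counit_generated (tlift_is_linear b) (tlift_is_linear bA))
  => [y z|y z y' z'|y z|a].
- by rewrite c_tens (tlift_tens bA) eps_j (linear_atZ j_linear).
- by rewrite !c_tens (algm_mul eps_morphism) mulZl mulZr scalerA mulrC.
- rewrite coproduct_op_tens (linear_atD (tlift_is_linear b)) !c_tens.
  rewrite (linear_atZ el) (algm_one eps_morphism) eps_P PZ /shiftP.
  have -> : (eps z)%:A = eps z :> k^o by exact: mulr1.
  have -> : - lambda *: eps z = - (eps z * lambda) :> k^o.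
    by rewrite -mulrN; apply: mulrC.
  by rewrite scalerDr scalerA scaleNr addrK.
- exact: coalg_counitr coA a.
Qed.

(* Q3 is the operator on B (x) (B (x) B) that both iterated coproducts intertwine
   with P. *)
Lemma coassoc u : tassoc (tmap Delta id (Delta u)) = tmap id Delta (Delta u).
Proof.
have li := @linear_id k B.
have lDi := tmap_linear Dl li; have liD := tmap_linear li Dl.
have la := @tassoc_linear k B B B.
have bL : bilinear_map (fun (s : tensor B B) (v : B) => tassoc (tens s v)).
  exact: linear_bilinear la (tens_bilinear _ _).
pose epsT : tensor B B -> k^o := tlift (fun p q => e p * e q : k^o).
have bE : bilinear_map (fun p q => e p * e q : k^o).
  split=> [q|p] a x y; rewrite el; first by rewrite mulrDl -mulrA.
  by rewrite mulrDr mulrCA.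
have epsT_tens p q : epsT (tens p q) = e p * e q by exact: tlift_tens bE p q.
have lE : linear epsT by exact: tlift_is_linear bE.
(* This is [eps] applied to the left counit law. *)
have epsT_Delta v : epsT (Delta v) = eps v.
  rewrite -[in RHS](counitl v); move: (Delta v) => t; move: t.
  have b := counitl_bilin el.
  apply: tens_ext => [//||p q]; first exact: linear_comp el (tlift_is_linear b).
  by rewrite epsT_tens (tlift_tens b) (linear_atZ el).
pose Q3 : tensor B (tensor B B) -> tensor B (tensor B B) :=
  tlift (fun w s => tens (shiftP w) ((epsT s : k) *: tens one one)
                    + tens w (coproduct_op s)).
have bQ3 : bilinear_map (fun w s =>
    tens (shiftP w) ((epsT s : k) *: tens one one) + tens w (coproduct_op s)).
  apply: bilinear_add; last exact: bilinear_tens li lQ.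
  exact: bilinear_tens shiftP_linear (linear_scale_vec _ lE).
have lQ3 : linear Q3 by exact: tlift_is_linear bQ3.
have Q3_tens w s : Q3 (tens w s) =
    tens (shiftP w) ((epsT s : k) *: tens one one) + tens w (coproduct_op s).
  exact: tlift_tens bQ3 w s.
have aBB := tmul_algebra aB aB.
have id_m : is_alg_morphism mul one mul one (@id B) by split.
have D1m := tmap_alg_morphism aB aB aBB aB Delta_morphism id_m.
have D2m := tmap_alg_morphism aB aB aB aBB id_m Delta_morphism.
have am := tassoc_alg_morphism aB aB aB.
have lD1 := linear_comp la lDi.
have D1Q t : tassoc (tmap Delta id (coproduct_op t)) =
    Q3 (tassoc (tmap Delta id t)).
  move: t; apply: tens_ext => [||v w].
  - exact: linear_comp lD1 lQ.
  - exact: linear_comp lQ3 lD1.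
  rewrite coproduct_op_tens (linear_atD lDi) !(tmap_tens Dl li) (linear_atD la).
  exact: (Q3_left (tens_bilinear B B) lQ coproduct_op_tens (tens_bilinear _ _) bL
    (@tens_span k B B) lQ3 (@tassoc_tens k B B B) Q3_tens epsT_tens Dl Delta_P).
have D2Q t : tmap id Delta (coproduct_op t) = Q3 (tmap id Delta t).
  move: t; apply: tens_ext => [||v w].
  - exact: linear_comp liD lQ.
  - exact: linear_comp lQ3 liD.
  rewrite coproduct_op_tens (linear_atD liD) !(tmap_tens li Dl).
  exact: (Q3_right Q3_tens Dl (algm_one Delta_morphism) Delta_P epsT_Delta).
have ljj := tmap_linear j_linear j_linear.
have ljjj := tmap_linear j_linear ljj.
have lDA := coalg_Delta_linear coA; have liA := @linear_id k A.
have laA := @tassoc_linear k A A A.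
(* On the image of [j] both iterated coproducts are induced by those of [A], where coassociativity
   is given. *)
have D1j t : tassoc (tmap Delta id (tmap j j t)) =
    tmap j (tmap j j) (tassoc (tmap DeltaA id t)).
  move: t; apply: tens_ext => [||y z].
  - exact: linear_comp lD1 ljj.
  - exact: linear_comp ljjj (linear_comp laA (tmap_linear lDA liA)).
  rewrite (tmap_tens j_linear j_linear) (tmap_tens Dl li) (tmap_tens lDA liA) Delta_j.
  move: (DeltaA y) => t; move: t; apply: tens_ext => [||p q].
  - exact: linear_comp la (linear_comp (tens_linl _) ljj).
  - exact: linear_comp ljjj (linear_comp laA (tens_linl _)).
  rewrite (tmap_tens j_linear j_linear) !tassoc_tens (tmap_tens j_linear ljj).
  by rewrite (tmap_tens j_linear j_linear).
have D2j t : tmap id Delta (tmap j j t) = tmap j (tmap j j) (tmap id DeltaA t).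
  move: t; apply: tens_ext => [||y z].
  - exact: linear_comp liD ljj.
  - exact: linear_comp ljjj (tmap_linear liA lDA).
  rewrite (tmap_tens j_linear j_linear) (tmap_tens li Dl) (tmap_tens liA lDA) Delta_j.
  by rewrite (tmap_tens j_linear ljj).
move: u; apply: generated => [|a|g h eg eh|g eg].
- by apply: equalizer_submodule; 
    [exact: linear_comp lD1 Dl | exact: linear_comp liD Dl].
- by rewrite Delta_j D1j D2j (coalg_coassoc coA).
- rewrite (algm_mul Delta_morphism) (algm_mul D1m) (algm_mul am) (algm_mul D2m).
  exact: f_equal2 eg eh.
- by rewrite Delta_P D1Q D2Q eg.
Qed.

Lemma coproduct_coalgebra : is_coalgebra Delta eps.
Proof.
split; [exact: Dl | exact: el | exact: coassoc | exact: counitl | exact: counitr].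
Qed.

End Coalgebra.
End CoproductOperator.

(** * The ground ring as target of the counit, and the assembly of the bialgebra *)

Lemma scalar_algebra (k : comNzRingType) :
  is_algebra ( *%R : k^o -> k^o -> k^o) 1.
Proof.
split; [split=> [v|u] a x y | exact: mulrA | exact: mul1r | exact: mulr1].
  by rewrite mulrDl -mulrA.
by rewrite mulrDr mulrCA.
Qed.

Lemma scalar_RB (k : comNzRingType) (lambda : k) :
  modified_RB (- lambda ^+ 2) ( *%R : k^o -> k^o -> k^o)
    (fun c : k^o => (- lambda) *: c).
Proof.
move=> x y; have sc (a b : k^o) : (a : k) *: b = a * b by [].
by rewrite !sc; ring.
Qed.

Theorem theorem3p4 (k : comNzRingType) (A : algType k)
    (DeltaA : A -> tensor A A) (epsA : A -> k^o)
    (bialgA : is_bialgebra *%R 1 DeltaA epsA)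
    (X : unital_basis A) (lambda : k) :
  exists (epsM : freeMRB X -> k^o)
         (DeltaM : freeMRB X -> tensor (freeMRB X) (freeMRB X)),
    [/\ is_the (is_epsM lambda epsA) epsM,
        is_the (is_DeltaM lambda DeltaA epsM) DeltaM
      & is_bialgebra (dia (- lambda ^+ 2)) (free_one X) DeltaM epsM].
Proof.
have [aA coA DA_m eA_m] := bialgA; have jm := jA_alg_morphism X (- lambda ^+ 2).
have aF := dia_algebra X (- lambda ^+ 2).
have lP : linear (fun c : k^o => - lambda *: c).
  exact: linear_scale (@linear_id k k^o).
have [eps [eps_m eps_j]] :=
  freeMRB_lift X (scalar_algebra k) lP (scalar_RB lambda) eA_m.
have [eps_am eps_P] := eps_m.
have PF_RB := wp_RB (dia_word_product X (- lambda ^+ 2)).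
have lPA := @PA_linear k A X.
have lQ : linear (QM lambda eps) := coproduct_op_linear lambda lPA eps_am.
have RBQ : modified_RB (- lambda ^+ 2)
    (tmul (dia (- lambda ^+ 2)) (dia (- lambda ^+ 2))) (QM lambda eps) :=
  coproduct_op_RB aF lPA PF_RB eps_am eps_P.
(* The algebra morphism on [A] whose lift is the coproduct. *)
have f_m : is_alg_morphism *%R 1 (tmul (dia (- lambda ^+ 2)) (dia (- lambda ^+ 2)))
    (tens (free_one X) (free_one X)) (fun a => tmap (jA X) (jA X) (DeltaA a)).
  have [lD D1 DM] := DA_m; have [lj j1 jM] := tmap_alg_morphism aA aA aF aF jm jm.
  split; first exact: linear_comp lj lD.
    by rewrite D1 j1.
  by move=> a b; rewrite DM jM.
have [Delta [Delta_m Delta_j]] := freeMRB_lift X (tmul_algebra aF aF) lQ RBQ f_m.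
have [Delta_am Delta_P] := Delta_m.
exists eps, Delta; split.
- split=> // g [gm gj]; apply: (freeMRB_lift_unique gm eps_m) => a.
  by rewrite gj eps_j.
- split=> // g [gm gj]; apply: (freeMRB_lift_unique gm Delta_m) => a.
  by rewrite gj Delta_j.
(* The lifts are algebra morphisms already, which leaves the coalgebra axioms. *)
split=> //.
exact: (coproduct_coalgebra aF lPA eps_am eps_P coA (algm_linear jm) Delta_am
  Delta_P Delta_j eps_j (@freeMRB_generated k A X (- lambda ^+ 2))).
Qed.
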